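(* The verification of safety properties under the release-acquire semantics for parameterized systems of the class $\mathsf{env}(\mathsf{nocas},\mathsf{acyc})$ is $\mathsf{PSPACE}$-hard.
   Context: Programs. Fix finite sets $\mathrm{Reg}$ (registers), $\mathrm{Var}$ (shared variables) and a finite data domain $\mathrm{Dom}$. Commands: $c ::= \mathsf{skip} \mid \mathsf{assume}(e(\bar r)) \mid \mathsf{assert}(\mathsf{false}) \mid r := e(\bar r) \mid c;c \mid c \oplus c \mid c^* \mid r := x \mid x := r \mid \mathsf{cas}(x,r_1,r_2)$. A program is $\mathsf{acyc}$ if it contains no $^*$ and $\mathsf{nocas}$ if it contains no $\mathsf{cas}$. RA semantics. Views are maps $vw:\mathrm{Var}\to\mathbb N$; messages are $(x,d,vw)$; a memory is a set of messages; a configuration is a memory together with a local configuration (command, register valuation, view) for each thread identifier in $\mathbb N$. Messages $(x_1,d_1,vw_1),(x_2,d_2,vw_2)$ are non-conflicting if $x_1\neq x_2$ or $vw_1(x_1)\neq vw_2(x_2)$ or $vw_1(x_1)=vw_2(x_2)=0$. A step is made by one thread with view $vw$: standard control-flow/register steps ($\mathsf{assume}(e)$ passes only if $e\ne0$; $\mathsf{assert}(\mathsf{false})$ leads to an error); load $r:=x$ picks $(x,d,vw')$ in memory with $vw(x)\le vw'(x)$, sets $r:=d$ and view to $vw\sqcup vw'$ (pointwise max); store $x:=r$ picks $vw'$ equal to $vw$ except $vw'(x)>vw(x)$ and adds $(x,rv(r),vw')$ if non-conflicting with every message in memory, view $:=vw'$; $\mathsf{cas}$ is an atomic load followed by a store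 with $x$-timestamps $ts$ and $ts+1$. Initially the memory is $\{(x,d_{\mathrm{init}},\mathbf 0)\}_{x\in\mathrm{Var}}$, all threads have zero registers and zero view. The class $\mathsf{env}(\mathsf{nocas},\mathsf{acyc})$: systems given by a single loop-free, CAS-free program $c_{\mathsf{env}}$ executed by every one of infinitely many threads (no distinguished threads). Safety verification: given such a system, decide whether some finite computation from the initial configuration leads to some thread executing $\mathsf{assert}(\mathsf{false})$. *)

(* Defs.v *)
From HB Require Import structures.
From mathcomp Require Import all_boot all_order all_algebra.

Set Implicit Arguments.
Unset Strict Implicit.
Unset Printing Implicit Defensive.

(** * Complexity classes *)

(** Deterministic multi-tape Turing machines.  Tapes are two-way infinite;
    a tape [(l, a, r)] has its head on [a], the cells in [l] (nearest first) to
    its left and those in [r] to its right, and blanks everywhere else. *)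

Inductive move := MLeft | MStay | MRight.

(** Tape symbols: [None] is the blank, [Some (inl b)] the input/output bit [b],
    and [Some (inr a)] an auxiliary work symbol. *)
Definition symbol (A : Type) : Type := option (bool + A).

Section Tapes.
Variable A : Type.

Definition tape : Type := seq (symbol A) * symbol A * seq (symbol A).

Definition tape_of (s : seq (symbol A)) : tape := ([::], head None s, behead s).

Definition tape_read (t : tape) : symbol A := t.1.2.

Definition tape_write (a : symbol A) (t : tape) : tape := (t.1.1, a, t.2).

Definition tape_move (m : move) (t : tape) : tape :=
  let: (l, a, r) := t in
  match m with
  | MLeft => (behead l, head None l, a :: r)
  | MStay => t
  | MRight => (a :: l, head None r, behead r)
  end.

(** Number of cells that are visited or initially occupied; it never decreases
    along a run. *)
Definition tape_space (t : tape) : nat := size t.1.1 + 1 + size t.2.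

Fixpoint leading_bits (s : seq (symbol A)) : seq bool :=
  if s is Some (inl b) :: s' then b :: leading_bits s' else [::].

Definition tape_output (t : tape) : seq bool := leading_bits (t.1.2 :: t.2).

End Tapes.

(** A machine with [k.+1] tapes. *)
Record TM (k : nat) := MkTM {
  tm_state : finType;
  tm_aux : finType;
  tm_start : tm_state;
  tm_halted : pred tm_state;
  tm_accepting : pred tm_state;
  tm_delta : tm_state -> {ffun 'I_k.+1 -> symbol tm_aux} ->
             tm_state * {ffun 'I_k.+1 -> symbol tm_aux * move} }.

Section Runs.
Variables (k : nat) (M : TM k).

Definition tm_config : Type := tm_state M * {ffun 'I_k.+1 -> tape (tm_aux M)}.

(** The input is on tape [ord0], the head on its first bit. *)
Definition tm_init (w : seq bool) : tm_config :=
  (tm_start M,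
   [ffun i => tape_of (if i == ord0 then [seq Some (inl b) | b <- w] else [::])]).

Definition tm_step (c : tm_config) : tm_config :=
  if tm_halted c.1 then c else
  let: (q, act) := tm_delta c.1 [ffun i => tape_read (c.2 i)] in
  (q, [ffun i => tape_move (act i).2 (tape_write (act i).1 (c.2 i))]).

Definition tm_run (w : seq bool) (t : nat) : tm_config :=
  iter t tm_step (tm_init w).

Definition tm_space (c : tm_config) : nat := \sum_i tape_space (c.2 i).

(** The output is on tape [ord_max], starting at the head. *)
Definition tm_output (c : tm_config) : seq bool := tape_output (c.2 ord_max).

End Runs.

Definition language : Type := seq bool -> Prop.

Definition in_PSPACE (L : language) : Prop :=
  exists (k : nat) (M : TM k) (p : {poly nat}), forall w : seq bool,
    (forall t, tm_space (tm_run M w t) <= p.[size w]%R) /\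
    (exists t, tm_halted (tm_run M w t).1 /\
               (L w <-> tm_accepting (tm_run M w t).1)).

Definition polytime_computable (f : seq bool -> seq bool) : Prop :=
  exists (k : nat) (M : TM k) (p : {poly nat}), forall w : seq bool,
    exists t, [/\ t <= p.[size w]%R, tm_halted (tm_run M w t).1
                & tm_output (tm_run M w t) = f w].

Definition polytime_reducible (L1 L2 : language) : Prop :=
  exists f : seq bool -> seq bool,
    polytime_computable f /\ (forall w, L1 w <-> L2 (f w)).

Definition PSPACE_hard (L : language) : Prop :=
  forall L' : language, in_PSPACE L' -> polytime_reducible L' L.

(** * Programs *)

Section Syntax.
Variables Reg Var Dom : Type.

(** [EIfEq e1 e2 e3 e4] is "if e1 = e2 then e3 else e4".  Over a finite [Dom]
    these expressions define every function of finitely many registers. *)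
Inductive expr :=
| EConst of Dom
| EReg of Reg
| EIfEq of expr & expr & expr & expr.

Inductive com :=
| CSkip
| CAssume of expr
| CAssertFalse
| CAssign of Reg & expr
| CSeq of com & com
| CChoice of com & com
| CStar of com
| CLoad of Reg & Var
| CStore of Var & Reg
| CCas of Var & Reg & Reg.

Fixpoint acyc (c : com) : bool :=
  match c with
  | CSeq c1 c2 | CChoice c1 c2 => acyc c1 && acyc c2
  | CStar _ => false
  | _ => true
  end.

Fixpoint nocas (c : com) : bool :=
  match c with
  | CSeq c1 c2 | CChoice c1 c2 => nocas c1 && nocas c2
  | CStar c1 => nocas c1
  | CCas _ _ _ => false
  | _ => true
  end.

End Syntax.

Arguments EConst {Reg Dom}.
Arguments EReg {Reg Dom}.
Arguments CSkip {Reg Var Dom}.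
Arguments CAssertFalse {Reg Var Dom}.
Arguments CAssume {Reg Var Dom}.
Arguments CAssign {Reg Var Dom}.
Arguments CLoad {Reg Var Dom}.
Arguments CStore {Reg Var Dom}.
Arguments CCas {Reg Var Dom}.

(** * Release-acquire semantics *)

Section RA.
Variables (Reg Var Dom : finType).
(** [zero] is the value 0 of the data domain. *)
Variables (zero dinit : Dom).

Definition view : Type := {ffun Var -> nat}.
Definition valuation : Type := {ffun Reg -> Dom}.
Definition message : Type := Var * Dom * view.
Definition memory : Type := message -> Prop.

Definition upd (I : finType) (T : Type) (f : {ffun I -> T}) (i : I) (a : T) :
  {ffun I -> T} := [ffun j => if j == i then a else f j].

Definition view0 : view := [ffun=> 0].
Definition view_join (v1 v2 : view) : view := [ffun x => maxn (v1 x) (v2 x)].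

Definition nonconflicting (m1 m2 : message) : Prop :=
  let: (x1, _, v1) := m1 in let: (x2, _, v2) := m2 in
  x1 <> x2 \/ v1 x1 <> v2 x2 \/ (v1 x1 = 0 /\ v2 x2 = 0).

Definition mem_add (mem : memory) (m : message) : memory :=
  fun m' => mem m' \/ m' = m.

Fixpoint eval (rv : valuation) (e : expr Reg Dom) : Dom :=
  match e with
  | EConst d => d
  | EReg r => rv r
  | EIfEq e1 e2 e3 e4 =>
      if eval rv e1 == eval rv e2 then eval rv e3 else eval rv e4
  end.

Definition lconfig : Type := com Reg Var Dom * valuation * view.

(** [thread_step mem lc mem' lc']: one step of a thread, [CSkip] being the
    terminated command. *)
Inductive thread_step (mem : memory) : lconfig -> memory -> lconfig -> Prop :=
| StepAssume e rv vw :
    eval rv e <> zero ->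
    thread_step mem (CAssume e, rv, vw) mem (CSkip, rv, vw)
| StepAssign r e rv vw :
    thread_step mem (CAssign r e, rv, vw) mem (CSkip, upd rv r (eval rv e), vw)
| StepSeqSkip c rv vw :
    thread_step mem (CSeq CSkip c, rv, vw) mem (c, rv, vw)
| StepSeq c1 c2 rv vw mem' c1' rv' vw' :
    thread_step mem (c1, rv, vw) mem' (c1', rv', vw') ->
    thread_step mem (CSeq c1 c2, rv, vw) mem' (CSeq c1' c2, rv', vw')
| StepChoiceL c1 c2 rv vw :
    thread_step mem (CChoice c1 c2, rv, vw) mem (c1, rv, vw)
| StepChoiceR c1 c2 rv vw :
    thread_step mem (CChoice c1 c2, rv, vw) mem (c2, rv, vw)
| StepStarStop c rv vw :
    thread_step mem (CStar c, rv, vw) mem (CSkip, rv, vw)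
| StepStarIter c rv vw :
    thread_step mem (CStar c, rv, vw) mem (CSeq c (CStar c), rv, vw)
| StepLoad r x d (vw' : view) rv (vw : view) :
    mem (x, d, vw') -> vw x <= vw' x ->
    thread_step mem (CLoad r x, rv, vw) mem (CSkip, upd rv r d, view_join vw vw')
| StepStore x r ts (rv : valuation) (vw : view) :
    let vw' := upd vw x ts in
    let msg := (x, rv r, vw') in
    vw x < ts -> (forall m, mem m -> nonconflicting msg m) ->
    thread_step mem (CStore x r, rv, vw) (mem_add mem msg) (CSkip, rv, vw')
| StepCas x r1 r2 (vw1 : view) (rv : valuation) (vw : view) :
    let vw' := upd (view_join vw vw1) x (vw1 x).+1 in
    let msg := (x, rv r2, vw') in
    mem (x, rv r1, vw1) -> vw x <= vw1 x ->
    (forall m, mem m -> nonconflicting msg m) ->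
    thread_step mem (CCas x r1 r2, rv, vw) (mem_add mem msg) (CSkip, rv, vw').

(** The next instruction of the command is [assert(false)], whose execution is
    always enabled and leads to the error. *)
Inductive executes_assert : com Reg Var Dom -> Prop :=
| ExecAssert : executes_assert CAssertFalse
| ExecSeq c1 c2 : executes_assert c1 -> executes_assert (CSeq c1 c2).

Definition config : Type := memory * (nat -> lconfig).

Inductive config_step : config -> config -> Prop :=
| ConfigStep mem th t mem' lc' :
    thread_step mem (th t) mem' lc' ->
    config_step (mem, th) (mem', fun u => if u == t then lc' else th u).

Inductive reachable (c0 : config) : config -> Prop :=
| ReachRefl : reachable c0 c0
| ReachStep c1 c2 : reachable c0 c1 -> config_step c1 c2 -> reachable c0 c2.

Definition init_memory : memory := fun m => exists x, m = (x, dinit, view0).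

(** Every thread executes the same program. *)
Definition init_config (cenv : com Reg Var Dom) : config :=
  (init_memory, fun=> (cenv, [ffun=> zero], view0)).

Definition unsafe (cenv : com Reg Var Dom) : Prop :=
  exists (cf : config) (t : nat),
    reachable (init_config cenv) cf /\ executes_assert (cf.2 t).1.1.

End RA.

(** * The safety verification problem as a language *)

(** The sets of registers, variables and data are part of the instance. *)
Record system := MkSystem {
  nreg : nat;
  nvar : nat;
  ndom : nat;
  sys_dinit : 'I_ndom.+1;
  sys_prog : com 'I_nreg 'I_nvar 'I_ndom.+1 }.

Definition system_unsafe (S : system) : Prop :=
  unsafe ord0 (sys_dinit S) (sys_prog S).

(** Binary encoding: prefix notation, tags and indices in unary. *)
Definition enc_nat (n : nat) : seq bool := rcons (nseq n true) false.

Section Encoding.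
Variables r v d : nat.

Fixpoint enc_expr (e : expr 'I_r 'I_d) : seq bool :=
  match e with
  | EConst a => enc_nat 0 ++ enc_nat a
  | EReg x => enc_nat 1 ++ enc_nat x
  | EIfEq e1 e2 e3 e4 =>
      enc_nat 2 ++ enc_expr e1 ++ enc_expr e2 ++ enc_expr e3 ++ enc_expr e4
  end.

Fixpoint enc_com (c : com 'I_r 'I_v 'I_d) : seq bool :=
  match c with
  | CSkip => enc_nat 0
  | CAssume e => enc_nat 1 ++ enc_expr e
  | CAssertFalse => enc_nat 2
  | CAssign x e => enc_nat 3 ++ enc_nat x ++ enc_expr e
  | CSeq c1 c2 => enc_nat 4 ++ enc_com c1 ++ enc_com c2
  | CChoice c1 c2 => enc_nat 5 ++ enc_com c1 ++ enc_com c2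
  | CStar c1 => enc_nat 6 ++ enc_com c1
  | CLoad x y => enc_nat 7 ++ enc_nat x ++ enc_nat y
  | CStore y x => enc_nat 8 ++ enc_nat y ++ enc_nat x
  | CCas y x1 x2 => enc_nat 9 ++ enc_nat y ++ enc_nat x1 ++ enc_nat x2
  end.

End Encoding.

Definition enc_system (S : system) : seq bool :=
  enc_nat (nreg S) ++ enc_nat (nvar S) ++ enc_nat (ndom S) ++
  enc_nat (sys_dinit S) ++ enc_com (sys_prog S).

Lemma enc_nat_cat_inj m n s t :
  enc_nat m ++ s = enc_nat n ++ t -> m = n /\ s = t.
Proof.
elim: m n => [|m IHm] [|n] //=; first by case.
by case=> /IHm [-> ->].
Qed.

Lemma enc_ord_cat_inj k (i j : 'I_k) s t :
  enc_nat i ++ s = enc_nat j ++ t -> i = j /\ s = t.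
Proof. by move/enc_nat_cat_inj => [/val_inj-> ->]. Qed.

Lemma enc_expr_cat_inj r d (e f : expr 'I_r 'I_d) s t :
  enc_expr e ++ s = enc_expr f ++ t -> e = f /\ s = t.
Proof.
elim: e f s t => [a|x|e1 IH1 e2 IH2 e3 IH3 e4 IH4] [b|y|f1 f2 f3 f4] s t;
  rewrite /= -?catA => -[] //.
- by move/enc_ord_cat_inj => [-> ->].
- by move/enc_ord_cat_inj => [-> ->].
- by move=> /IH1 [-> /IH2 [-> /IH3 [-> /IH4 [-> ->]]]].
Qed.

Lemma enc_com_cat_inj r v d (c1 c2 : com 'I_r 'I_v 'I_d) s t :
  enc_com c1 ++ s = enc_com c2 ++ t -> c1 = c2 /\ s = t.
Proof.
elim: c1 c2 s t => [|e||x e|a IHa b IHb|a IHa b IHb|a IHa|x y|y x|y x1 x2]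
  [|e'||x' e'|a' b'|a' b'|a'|x' y'|y' x'|y' x1' x2'] s t;
  rewrite /= -?catA => -[] //.
- by move=> /enc_expr_cat_inj [-> ->].
- by move=> /enc_ord_cat_inj [-> /enc_expr_cat_inj [-> ->]].
- by move=> /IHa [-> /IHb [-> ->]].
- by move=> /IHa [-> /IHb [-> ->]].
- by move=> /IHa [-> ->].
- by move=> /enc_ord_cat_inj [-> /enc_ord_cat_inj [-> ->]].
- by move=> /enc_ord_cat_inj [-> /enc_ord_cat_inj [-> ->]].
- by move=> /enc_ord_cat_inj [-> /enc_ord_cat_inj [-> /enc_ord_cat_inj [-> ->]]].
Qed.

Lemma enc_system_inj : injective enc_system.
Proof.
case=> r v d a c [r' v' d' a' c']; rewrite /enc_system /=.
move=> /enc_nat_cat_inj [? /enc_nat_cat_inj [? /enc_nat_cat_inj [?]]].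
subst r' v' d' => /enc_ord_cat_inj [<-] E.
by have [-> _] := @enc_com_cat_inj _ _ _ c c' [::] [::] (congr1 (cat^~ [::]) E).
Qed.

(** Yes-instances are the encodings of the unsafe systems of the class
    env(nocas, acyc). *)
Definition env_nocas_acyc_safety : language := fun w =>
  exists S : system,
    [/\ w = enc_system S, nocas (sys_prog S), acyc (sys_prog S)
      & system_unsafe S].

(* Main.v *)
From HB Require Import structures.
From mathcomp Require Import all_boot all_order all_algebra zify.
Require Import Defs.

Set Implicit Arguments.
Unset Strict Implicit.
Unset Printing Implicit Defensive.

(** Loading the initial message of [x] requires a view that is zero at [x], so
    the zero set of a view, which every message carries, is a memory that a
    thread can test and can only shrink.  A configuration with cells [j] over a
    finite alphabet [G] is stored as the set of variables [(j, g)] such that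
    cell [j] contains [g]: these stay at zero and the others are written to.

    A space-bounded machine becomes a one-dimensional automaton, and its
    exponentially long runs are composed by repeated doubling.  A message at
    level [i] carries in its view a pair [(A, B)] such that [B] is reached from
    [A] in [2 ^ i] steps.  A thread at level [i + 1] reads two of them, in
    disjoint sets of variables because reading joins the views, checks that the
    target of the first is the source of the second, and copies the outer
    configurations to fresh variables.  No guess needs to be remembered: two
    inconsistent guesses for a cell pollute all its variables, and such a
    message is useless.

    The instance is written by a Turing machine obtained from a small language
    of nested loops over unary counters. *)

(** * Programs acting on zero sets *)

(** A loop-free thread performs polynomially many actions and has two one-bit registers, so it can
    neither follow an exponential run nor store a configuration; all information sits in views.
    Views only grow, so a zero set is never repaired: each composition needs the variables of a
    fresh level. Messages persist and threads are unlimited, so the binary tree of compositions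
    costs no memory.

    Safety cannot speak of the pair a message was meant to carry. Its claim ranges over all ways to
    select a zero variable for every cell, and is empty once a cell is fully polluted. Hence a
    consumer must test every cell, even one whose content is irrelevant to it.

    The tapes move under a fixed head, so head positions need not be stored; the price is an
    automaton in which every cell sees cell 0. A single number [X] bounds both the space and the
    logarithm of the time, and so governs cells as well as levels. *)

Section ViewPrograms.
Variable V : finType.

Local Notation pcom := (com 'I_2 V 'I_2).
Local Notation view := (view V).
Local Notation valuation := (valuation 'I_2 'I_2).
Local Notation message := (message V 'I_2).
Local Notation memory := (memory V 'I_2).
Local Notation tstep := (@thread_step 'I_2 V 'I_2 ord0).

(** In a line, [true] marks a check and [false] a pollution; a block offers its lines as
    alternatives. A thread reads, runs one line of every block, and ends by announcing its result
    ([Some x]) or by the assertion ([None]). With all reads first, a check can be interpreted in the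
    view right after them. *)
Definition line : Type := seq (bool * V).
Definition block : Type := seq line.
Definition thread : Type := seq V * seq block * option V.

(* The initial value is 1, and only 0 is ever stored: it comes from register 1,
   which is never assigned. *)
Definition chk (x : V) : pcom := CSeq (CLoad ord0 x) (CAssume (EReg ord0)).
Definition rd (x : V) : pcom :=
  CSeq (CLoad ord0 x)
       (CAssume (EIfEq (EReg ord0) (EConst ord0) (EConst ord_max) (EConst ord0))).
Definition pol (x : V) : pcom := CStore x ord_max.

Definition cseq (l : seq pcom) : pcom := foldr (@CSeq _ _ _) CSkip l.
(** The list ends in a blocked command and not in [CSkip], since running past the last alternative
    must not count as a choice. *)
Definition calt (l : seq pcom) : pcom :=
  foldr (@CChoice _ _ _) (CAssume (EConst ord0)) l.

Definition com_act (a : bool * V) : pcom := if a.1 then chk a.2 else pol a.2.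
Definition com_line (ln : line) : pcom := cseq (map com_act ln).
Definition com_block (b : block) : pcom := calt (map com_line b).
Definition com_last (o : option V) : pcom :=
  if o is Some x then pol x else CAssertFalse.
Definition com_thread (t : thread) : pcom :=
  cseq (map rd t.1.1 ++ map com_block t.1.2 ++ [:: com_last t.2]).
Definition com_prog (p : seq thread) : pcom := calt (map com_thread p).

Lemma acyc_cseq l : acyc (cseq l) = all (@acyc _ _ _) l.
Proof. by elim: l => //= c l ->. Qed.
Lemma acyc_calt l : acyc (calt l) = all (@acyc _ _ _) l.
Proof. by elim: l => //= c l ->. Qed.
Lemma nocas_cseq l : nocas (cseq l) = all (@nocas _ _ _) l.
Proof. by elim: l => //= c l ->. Qed.
Lemma nocas_calt l : nocas (calt l) = all (@nocas _ _ _) l.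
Proof. by elim: l => //= c l ->. Qed.

Lemma acyc_com_prog p : acyc (com_prog p).
Proof.
rewrite acyc_calt all_map; apply/allP => -[[rds blks] o] _ /=.
rewrite acyc_cseq !all_cat !all_map; apply/and3P; split.
- exact/allP.
- apply/allP => b _ /=; rewrite acyc_calt all_map; apply/allP => ln _ /=.
  by rewrite acyc_cseq all_map; apply/allP => -[[] x].
- by case: o.
Qed.

Lemma nocas_com_prog p : nocas (com_prog p).
Proof.
rewrite nocas_calt all_map; apply/allP => -[[rds blks] o] _ /=.
rewrite nocas_cseq !all_cat !all_map; apply/and3P; split.
- exact/allP.
- apply/allP => b _ /=; rewrite nocas_calt all_map; apply/allP => ln _ /=.
  by rewrite nocas_cseq all_map; apply/allP => -[[] x].
- by case: o.
Qed.

Definition vle (v w : view) : Prop := forall x, v x <= w x.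

Lemma vle_trans v u w : vle u v -> vle v w -> vle u w.
Proof. by move=> h1 h2 x; apply: leq_trans (h1 x) (h2 x). Qed.
Lemma vle_joinl v w : vle v (view_join v w).
Proof. by move=> x; rewrite ffunE leq_maxl. Qed.
Lemma vle_joinr v w : vle w (view_join v w).
Proof. by move=> x; rewrite ffunE leq_maxr. Qed.
Lemma vle_upd (v : view) x ts : v x < ts -> vle v (upd v x ts).
Proof. by move=> h y; rewrite ffunE; case: eqP => // ->; apply: ltnW. Qed.

(** * Safety *)

Section WP.
Variable I : message -> Prop.

(* Partial correctness of one thread under the assumption, and with the
   guarantee, that every message in memory satisfies [I]. *)
Fixpoint wp (c : pcom) (Q : valuation -> view -> Prop) (rv : valuation)
    (vw : view) : Prop :=
  match c with
  | CSkip => Q rv vw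
  | CAssume e => eval rv e <> ord0 -> Q rv vw
  | CAssertFalse => False
  | CAssign r e => Q (upd rv r (eval rv e)) vw
  | CSeq c1 c2 => wp c1 (wp c2 Q) rv vw
  | CChoice c1 c2 => wp c1 Q rv vw /\ wp c2 Q rv vw
  | CLoad r x => forall d (vw' : view), I (x, d, vw') -> vw x <= vw' x ->
      Q (upd rv r d) (view_join vw vw')
  | CStore x r => forall ts, vw x < ts ->
      I (x, rv r, upd vw x ts) /\ Q rv (upd vw x ts)
  | CStar _ | CCas _ _ _ => False
  end.

Lemma wp_step mem lc mem' lc' : tstep mem lc mem' lc' ->
  (forall m, mem m -> I m) ->
  forall Q, wp lc.1.1 Q lc.1.2 lc.2 ->
  (forall m, mem' m -> I m) /\ wp lc'.1.1 Q lc'.1.2 lc'.2.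
Proof.
elim=> //=.
- by move=> e rv vw ev hI Q H; split=> //; apply: H.
- by move=> c1 c2 rv vw mem2 c1' rv' vw' _ IH hI Q H; exact: IH.
- by move=> c1 c2 rv vw hI Q [].
- by move=> c1 c2 rv vw hI Q [].
- by move=> r x d vw' rv vw hm le hI Q H; split=> //; apply: H => //; apply: hI.
- move=> x r ts rv vw lt _ hI Q H; have [h1 h2] := H _ lt.
  by split=> // m [/hI|->].
Qed.

Lemma wp_executes_assert c Q rv vw : wp c Q rv vw -> ~ executes_assert c.
Proof.
move=> h ex; elim: ex Q rv vw h => //= c1 c2 _ IH Q rv vw; exact: IH.
Qed.

(** [wp] mentions the invariant [I] but not the memory, so a step of one thread cannot invalidate
    the preconditions of the others, and one thread can be verified in isolation. *)
Lemma wp_safe (c : pcom) :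
  (forall m, init_memory ord_max m -> I m) ->
  wp c (fun _ _ => True) [ffun=> ord0] (view0 V) -> ~ unsafe ord0 ord_max c.
Proof.
move=> hI hc [cf [t [hr]]].
have [_ /(_ t) H] : (forall m, cf.1 m -> I m) /\
   (forall u, wp (cf.2 u).1.1 (fun _ _ => True) (cf.2 u).1.2 (cf.2 u).2).
  elim: hr => [//|c1 c2 _ [IH1 IH2] st].
  case: st IH1 IH2 => mem th u mem' lc' st /= IH1 IH2.
  have [h1 h2] := wp_step st IH1 (IH2 u).
  by split=> // u'; case: eqP.
exact: wp_executes_assert H.
Qed.

Lemma wp_calt (T : eqType) (f : T -> pcom) (l : seq T) Q rv vw :
  (forall c, c \in l -> wp (f c) Q rv vw) -> wp (calt (map f l)) Q rv vw.
Proof.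
elim: l => [|c l IH] H; first by [].
split; first by apply: H; rewrite mem_head.
by apply: IH => d dl; apply: H; rewrite in_cons dl orbT.
Qed.

End WP.

(** Views only grow, so a check is pulled back to the earlier view [vw0] and a pollution pushed
    forward to the later view [vw]. In [wp_thread] these are the views after the reads and before
    the last store. *)
Definition line_post (ln : line) (vw0 vw : view) : Prop :=
  forall a, a \in ln -> if a.1 then vw0 a.2 = 0 else 0 < vw a.2.

Lemma line_post_mono ln vw0 vw vw' :
  vle vw vw' -> line_post ln vw0 vw -> line_post ln vw0 vw'.
Proof.
move=> h H [[] x] /H //= lt; exact: leq_trans lt (h x).
Qed.

Section Safety.
Variable Inv : V -> view -> Prop.
Hypothesis Inv_mono : forall x v w, vle v w -> Inv x v -> Inv x w.

(** The data value separates initial messages from stored ones: a successful check yields a zero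
    timestamp, a successful read yields [Inv]. *)
Definition msg_inv (m : message) : Prop :=
  let: (x, d, vw) := m in
  (d = ord_max -> vw x = 0) /\ (d = ord0 -> Inv x vw).

Local Notation wp := (wp msg_inv).

Lemma wp_chk x Q (rv : valuation) (vw : view) : rv ord_max = ord0 ->
  (vw x = 0 -> forall (rv' : valuation) (vw' : view), rv' ord_max = ord0 -> vle vw vw' -> Q rv' vw') ->
  wp (chk x) Q rv vw.
Proof.
move=> hr H /= d vw' [h1 h2] le; rewrite ffunE eqxx => nz.
have dm : d = ord_max by case: d nz {h1 h2} => [[|[|]]] // p nz; [case: nz|]; exact: val_inj.
apply: H; first by move: le; rewrite h1 // leqn0 => /eqP.
  by rewrite ffunE.
exact: vle_joinl.
Qed.

Lemma wp_rd x Q (rv : valuation) (vw : view) : rv ord_max = ord0 ->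
  (forall (rv' : valuation) (vw' : view), rv' ord_max = ord0 -> vle vw vw' -> Inv x vw' -> Q rv' vw') ->
  wp (rd x) Q rv vw.
Proof.
move=> hr H /= d vw' [h1 h2] le; rewrite ffunE eqxx.
case: eqP => // d0 _; apply: H; first by rewrite ffunE.
  exact: vle_joinl.
exact: Inv_mono (@vle_joinr _ _) (h2 d0).
Qed.

Lemma wp_pol x Q (rv : valuation) (vw : view) : rv ord_max = ord0 ->
  (forall vw', vle vw vw' -> 0 < vw' x -> Inv x vw' /\ Q rv vw') ->
  wp (pol x) Q rv vw.
Proof.
move=> hr H /= ts lt.
have [|h1 h2] := H _ (vle_upd lt); first by rewrite ffunE eqxx; apply: leq_trans lt.
by split=> //; split=> //; rewrite hr.
Qed.

Lemma wp_line vw0 ln Q (rv : valuation) (vw : view) :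
  (forall a, a \in ln -> a.1 = false -> forall w, Inv a.2 w) ->
  rv ord_max = ord0 -> vle vw0 vw ->
  (forall (rv' : valuation) (vw' : view), rv' ord_max = ord0 -> vle vw vw' -> line_post ln vw0 vw' ->
     Q rv' vw') ->
  wp (com_line ln) Q rv vw.
Proof.
rewrite /com_line; elim: ln rv vw => [|[[] x] ln IH] rv vw hln hr le0 HQ.
- exact: HQ.
- apply: wp_chk => // vx rv' vw' hr' le'; apply: IH => //.
  + by move=> a al; apply: hln; rewrite in_cons al orbT.
  + exact: vle_trans le0 le'.
  + move=> rv2 vw2 hr2 le2 lp; apply: HQ => //; first exact: vle_trans le' le2.
    move=> a; rewrite in_cons => /orP[/eqP->|/lp//] /=.
    by apply/eqP; rewrite -leqn0 -vx.
- apply: wp_pol => // vw' le' pos; split; first exact: (hln _ (mem_head _ _)).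
  apply: IH => //.
  + by move=> a al; apply: hln; rewrite in_cons al orbT.
  + exact: vle_trans le0 le'.
  + move=> rv2 vw2 hr2 le2 lp; apply: HQ => //; first exact: vle_trans le' le2.
    move=> a; rewrite in_cons => /orP[/eqP->|/lp//] /=.
    exact: leq_trans pos (le2 x).
Qed.

(** Pollutions are messages as well and must satisfy [Inv] in any view; only the last store may rely
    on what was read and checked. *)
Definition thread_ok (t : thread) : Prop :=
  (forall b ln a, b \in t.1.2 -> ln \in b -> a \in ln -> a.1 = false ->
     forall w, Inv a.2 w) /\
  (forall vw0 vw, vle vw0 vw -> (forall x, x \in t.1.1 -> Inv x vw0) ->
     (forall b, b \in t.1.2 -> exists2 ln, ln \in b & line_post ln vw0 vw) ->
     if t.2 is Some x then Inv x vw else False).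

Lemma wp_thread t (rv : valuation) (vw : view) :
  thread_ok t -> rv ord_max = ord0 ->
  wp (com_thread t) (fun _ _ => True) rv vw.
Proof.
case: t => -[rds blks] o [/= hpol hlast] hr; rewrite /com_thread /=.
(* Induction on the reads still to be done; earlier ones stay valid because [Inv] is upward closed
   in the view. *)
suff H (l : seq V) (rv1 : valuation) (vw1 : view) : rv1 ord_max = ord0 ->
    (forall x, x \in rds -> x \in l \/ Inv x vw1) ->
    wp (cseq (map rd l ++ map com_block blks ++ [:: com_last o]))
       (fun _ _ => True) rv1 vw1.
  by apply: H => // x; left.
elim: l rv1 vw1 => [|x l IH] {hr rv vw} rv vw hr hl; last first.
  apply: wp_rd => // rv' vw' hr' le ix; apply: IH => // y /hl.
  rewrite in_cons => -[/orP[/eqP->|]|iy]; first by right.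
    by left.
  by right; apply: Inv_mono iy.
have {hl} hl : forall x, x \in rds -> Inv x vw by move=> x /hl[].
rewrite cat0s; suff H (l : seq block) (rv1 : valuation) (vw1 : view) : rv1 ord_max = ord0 -> {subset l <= blks} ->
    (forall b, b \in blks ->
       b \in l \/ exists2 ln, ln \in b & line_post ln vw vw1) ->
    vle vw vw1 ->
    wp (cseq (map com_block l ++ [:: com_last o])) (fun _ _ => True) rv1 vw1.
  by apply: H => // b; left.
(* From here on [vw0] is the view after all reads, to which later checks are referred. *)
move: vw hl => vw0 hl.
elim: l rv1 vw1 => [|b l IH] {hr rv} rv vw hr sl hb le0; last first.
  apply: wp_calt => ln lnb; apply: (@wp_line vw0) => //.
    by move=> a; apply: hpol lnb; apply: sl; rewrite mem_head.
  move=> rv' vw' hr' le lp; apply: IH => //.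
  - by move=> c cl; apply: sl; rewrite in_cons cl orbT.
  - move=> c /hb; rewrite in_cons => -[/orP[/eqP->|]|[ln' ln'c lp']].
    + by right; exists ln.
    + by left.
    + by right; exists ln' => //; apply: line_post_mono lp'.
  - exact: vle_trans le0 le.
have {hb} hb : forall b, b \in blks -> exists2 ln, ln \in b & line_post ln vw0 vw.
  by move=> b /hb[].
case: o hlast => [x|] hlast; last exact: hlast hl hb.
apply: (wp_pol (Q := fun _ _ => True)) => // vw' le _; split => //.
by apply: Inv_mono (hlast _ _ le0 hl hb).
Qed.

Lemma safe_com_prog (p : seq thread) :
  (forall t, t \in p -> thread_ok t) -> ~ unsafe ord0 ord_max (com_prog p).
Proof.
move=> hp; apply: (@wp_safe msg_inv) => [m [x ->]|].
  by split=> //; rewrite ffunE.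
by apply: wp_calt => t /hp ht; apply: wp_thread => //; rewrite ffunE.
Qed.

End Safety.

(** * Reachability *)

Inductive truns : memory -> lconfig 'I_2 V 'I_2 -> memory ->
    lconfig 'I_2 V 'I_2 -> Prop :=
| TrunsRefl mem lc : truns mem lc mem lc
| TrunsStep mem lc mem1 lc1 mem2 lc2 :
    tstep mem lc mem1 lc1 -> truns mem1 lc1 mem2 lc2 -> truns mem lc mem2 lc2.

Lemma truns_trans mem lc mem1 lc1 mem2 lc2 :
  truns mem lc mem1 lc1 -> truns mem1 lc1 mem2 lc2 -> truns mem lc mem2 lc2.
Proof. by elim=> // ? ? ? ? ? ? st _ IH /IH; apply: TrunsStep. Qed.

Lemma truns_seq mem lc mem1 lc1 (c2 : pcom) : truns mem lc mem1 lc1 ->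
  truns mem (CSeq lc.1.1 c2, lc.1.2, lc.2) mem1 (CSeq lc1.1.1 c2, lc1.1.2, lc1.2).
Proof.
elim=> [*|m l m1 l1 m2 l2 st _ IH]; first exact: TrunsRefl.
apply: TrunsStep IH; case: l st => -[c rv] vw; case: l1 => -[c1 rv1] vw1 /= st.
exact: StepSeq.
Qed.

Lemma truns_cons mem c1 l rv vw mem1 rv1 vw1 mem2 rv2 vw2 c2 :
  truns mem (c1, rv, vw) mem1 (CSkip, rv1, vw1) ->
  truns mem1 (cseq l, rv1, vw1) mem2 (c2, rv2, vw2) ->
  truns mem (cseq (c1 :: l), rv, vw) mem2 (c2, rv2, vw2).
Proof.
move=> h1 h2; apply: truns_trans (truns_seq (cseq l) h1) _ => /=.
by apply: TrunsStep h2; apply: StepSeqSkip.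
Qed.

Lemma truns_calt (T : eqType) (f : T -> pcom) (l : seq T) t mem rv vw :
  t \in l -> truns mem (calt (map f l), rv, vw) mem (f t, rv, vw).
Proof.
elim: l => //= u l IH; rewrite in_cons => /orP[/eqP<-|tl].
  by apply: TrunsStep (TrunsRefl _ _); apply: StepChoiceL.
by apply: TrunsStep (IH tl); apply: StepChoiceR.
Qed.

(** The bound [B] leaves room for a fresh timestamp, so no store is ever blocked by a conflict. *)
Definition good_mem (mem : memory) : Prop :=
  (forall x, mem (x, ord_max, view0 V)) /\
  exists B, forall m, mem m -> m.2 m.1.1 <= B.

Definition vsub (vw : view) (Z : V -> Prop) : Prop := forall y, 0 < vw y -> Z y.

Definition mem_sub (mem mem' : memory) : Prop := forall m, mem m -> mem' m.

Lemma truns_chk mem x (rv : valuation) (vw : view) :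
  good_mem mem -> rv ord_max = ord0 -> vw x = 0 ->
  exists rv' : valuation, truns mem (chk x, rv, vw) mem (CSkip, rv', vw) /\ rv' ord_max = ord0.
Proof.
move=> [h _] hr vx; exists (upd rv ord0 ord_max); rewrite !ffunE; split=> //.
have -> : (CSkip, upd rv ord0 ord_max, vw) =
          (CSkip, upd rv ord0 ord_max, view_join vw (view0 V)) :> lconfig _ _ _.
  by congr (_, _); apply/ffunP => y; rewrite !ffunE maxn0.
rewrite -[chk x]/(CSeq _ (CAssume _)).
apply: TrunsStep; first by apply: StepSeq; apply: (StepLoad _ _ _ (h x)); rewrite vx.
apply: TrunsStep; first exact: StepSeqSkip.
apply: TrunsStep; last exact: TrunsRefl.
by apply: StepAssume; rewrite /= ffunE eqxx.
Qed.

Lemma truns_rd mem x (rv : valuation) (vw vw1 : view) :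
  mem (x, ord0, vw1) -> rv ord_max = ord0 -> vw x <= vw1 x ->
  exists rv' : valuation, truns mem (rd x, rv, vw) mem (CSkip, rv', view_join vw vw1)
    /\ rv' ord_max = ord0.
Proof.
move=> hm hr le; exists (upd rv ord0 ord0); rewrite !ffunE; split=> //.
apply: TrunsStep; first by apply: StepSeq; apply: (StepLoad _ _ _ hm).
apply: TrunsStep; first exact: StepSeqSkip.
apply: TrunsStep; last exact: TrunsRefl.
by apply: StepAssume; rewrite /= ffunE eqxx.
Qed.

Lemma truns_pol mem x (rv : valuation) (vw : view) (Z : V -> Prop) :
  good_mem mem -> rv ord_max = ord0 -> vsub vw Z -> Z x ->
  exists mem' vw', [/\ truns mem (pol x, rv, vw) mem' (CSkip, rv, vw'),
    good_mem mem', mem_sub mem mem', vsub vw' Z & mem' (x, ord0, vw')].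
Proof.
move=> [h [B hB]] hr vZ Zx; pose ts := (maxn B (vw x)).+1.
exists (mem_add mem (x, ord0, upd vw x ts)), (upd vw x ts); split.
- apply: TrunsStep (TrunsRefl _ _); 
  have := @StepStore _ _ _ ord0 mem x ord_max ts rv vw; rewrite hr; apply.
    by rewrite ltnS leq_maxr.
  move=> [[y d] v] /hB /= le; right; left => e.
  have : upd vw x ts x <= B by rewrite e.
  by rewrite ffunE eqxx leqNgt ltnS leq_maxl.
- split; first by move=> y; left.
  exists ts => m [/hB le|->/=]; last by rewrite ffunE eqxx.
  by apply: leq_trans le _; rewrite ltnW // ltnS leq_maxl.
- by left.
- by move=> y; rewrite ffunE; case: eqP => [->|_ /vZ].
- by right.
Qed.

Definition line_ok (Z : V -> Prop) (ln : line) : Prop :=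
  forall a, a \in ln -> if a.1 then ~ Z a.2 else Z a.2.

Lemma truns_line Z ln mem (rv : valuation) (vw : view) :
  good_mem mem -> rv ord_max = ord0 -> vsub vw Z -> line_ok Z ln ->
  exists mem' (rv' : valuation) vw', [/\ truns mem (com_line ln, rv, vw) mem' (CSkip, rv', vw'),
    good_mem mem', mem_sub mem mem', vsub vw' Z & rv' ord_max = ord0].
Proof.
rewrite /com_line; elim: ln mem rv vw => [|a ln IH] mem rv vw gm hr vZ ok.
  by exists mem, rv, vw; split=> //; apply: TrunsRefl.
have ok' : line_ok Z ln by move=> b bl; apply: ok; rewrite in_cons bl orbT.
case: a ok => [[] x] /(_ _ (mem_head _ _)) /= Zx.
  have vx : vw x = 0 by apply/eqP; rewrite -leqn0 leqNgt; apply/negP => /vZ.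
  have [rv1 [h1 hr1]] := truns_chk gm hr vx.
  have [mem2 [rv2 [vw2 [h2 *]]]] := IH _ _ _ gm hr1 vZ ok'.
  by exists mem2, rv2, vw2; split=> //; apply: truns_cons h1 h2.
have [mem1 [vw1 [h1 gm1 s1 vZ1 _]]] := truns_pol gm hr vZ Zx.
have [mem2 [rv2 [vw2 [h2 ? s2 ? ?]]]] := IH _ _ _ gm1 hr vZ1 ok'.
exists mem2, rv2, vw2; split=> //; first exact: truns_cons h1 h2.
by move=> m /s1/s2.
Qed.

Lemma truns_blocks Z (blks : seq block) mem (rv : valuation) (vw : view) rest :
  good_mem mem -> rv ord_max = ord0 -> vsub vw Z ->
  (forall b, b \in blks -> exists2 ln, ln \in b & line_ok Z ln) ->
  exists mem2 (rv2 : valuation) vw2,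
    [/\ good_mem mem2, mem_sub mem mem2, vsub vw2 Z, rv2 ord_max = ord0 &
      forall mem3 lc3, truns mem2 (cseq rest, rv2, vw2) mem3 lc3 ->
        truns mem (cseq (map com_block blks ++ rest), rv, vw) mem3 lc3].
Proof.
elim: blks mem rv vw => [|b blks IH] mem rv vw gm hr vZ hb.
  by exists mem, rv, vw; split.
have [ln lnb ok] := hb _ (mem_head _ _).
have [mem1 [rv1 [vw1 [h1 gm1 s1 vZ1 hr1]]]] := truns_line gm hr vZ ok.
have [|mem3 [rv3 [vw3 [? s3 ? ? h3]]]] := IH mem1 rv1 vw1 gm1 hr1 vZ1.
  by move=> c cb; apply: hb; rewrite in_cons cb orbT.
exists mem3, rv3, vw3; split=> // [m /s1/s3//|mem4 [[c4 rv4] vw4] /h3 h4].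
by apply: truns_cons h4; apply: truns_trans (truns_calt _ _ _ _ lnb) h1.
Qed.

Section Reach.
Variable p : seq thread.

Local Notation config := (config 'I_2 V 'I_2).
Local Notation lc0 := ((com_prog p, [ffun=> ord0], view0 V) : lconfig 'I_2 V 'I_2).

Definition good (cf : config) : Prop :=
  good_mem cf.1 /\ exists T, forall t, T <= t -> cf.2 t = lc0.

Lemma reachable_trans (c1 c2 c3 : config) :
  reachable ord0 c1 c2 -> reachable ord0 c2 c3 -> reachable ord0 c1 c3.
Proof. by move=> h; elim=> // ? ? _; apply: ReachStep. Qed.

Lemma truns_reachable mem lc mem' lc' t (th : nat -> lconfig 'I_2 V 'I_2) :
  truns mem lc mem' lc' -> th t = lc ->
  exists th', [/\ reachable ord0 (mem, th) (mem', th'), th' t = lc'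
    & forall u, u != t -> th' u = th u].
Proof.
move=> h; elim: h th => [m l|m l m1 l1 m2 l2 st _ IH] th tht.
  by exists th; split=> //; apply: ReachRefl.
have [|th' [hr h1 h2]] := IH (fun u => if u == t then l1 else th u).
  by rewrite eqxx.
exists th'; split=> //; last by move=> u ut; rewrite h2 // (negPf ut).
apply: reachable_trans hr; apply: ReachStep (ReachRefl _ _) _.
by apply: ConfigStep; rewrite tht.
Qed.

(** Quantified over all good configurations, so that it can be invoked at any time and repeatedly:
    messages are collected one after another and none is lost. *)
Definition avail (x : V) (Z : V -> Prop) : Prop :=
  forall cf, good cf -> exists cf' vw, [/\ reachable ord0 cf cf', good cf',
    mem_sub cf.1 cf'.1, cf'.1 (x, ord0, vw) & vsub vw Z].

Lemma avail_mono x (Z Z' : V -> Prop) :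
  (forall y, Z y -> Z' y) -> avail x Z -> avail x Z'.
Proof.
move=> sZ h cf /h[cf' [vw [? ? ? ? vZ]]]; exists cf', vw; split=> // y /vZ.
exact: sZ.
Qed.

Lemma good_fresh_run (cf : config) mem' lc' : good cf ->
  truns cf.1 lc0 mem' lc' -> good_mem mem' ->
  exists cf' t, [/\ reachable ord0 cf cf', good cf', cf'.1 = mem' & cf'.2 t = lc'].
Proof.
case: cf => mem th [gm [T hT]] /= h gm'.
have [th' [hr h1 h2]] := truns_reachable h (hT T (leqnn T)).
exists (mem', th'), T; split=> //; split=> //; exists T.+1 => t lt.
by rewrite /= h2 ?hT 1?ltnW // neq_ltn lt orbT.
Qed.

Section Thread.
Variables (rds : seq V) (blks : seq block) (o : option V).
Variables (Zr : V -> V -> Prop) (Z : V -> Prop).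
Hypotheses (tp : (rds, blks, o) \in p) (urds : uniq rds)
  (av : forall y, y \in rds -> avail y (Zr y))
  (sZr : forall y z, y \in rds -> Zr y z -> Z z)
  (nZr : forall y z, y \in rds -> z \in rds -> y != z -> ~ Zr y z)
  (okb : forall b, b \in blks -> exists2 ln, ln \in b & line_ok Z ln).

Lemma avail_reads (cf : config) : good cf ->
  exists cf', [/\ reachable ord0 cf cf', good cf', mem_sub cf.1 cf'.1 &
    forall y, y \in rds -> exists2 vw, cf'.1 (y, ord0, vw) & vsub vw (Zr y)].
Proof.
move=> gcf; suff H (l : seq V) : {subset l <= rds} ->
    exists cf', [/\ reachable ord0 cf cf', good cf', mem_sub cf.1 cf'.1 &
    forall y, y \in l -> exists2 vw, cf'.1 (y, ord0, vw) & vsub vw (Zr y)].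
  exact: H.
elim: l => [|y l IH] sl.
  by exists cf; split=> //; apply: ReachRefl.
have [|cf1 [h1 g1 s1 m1]] := IH; first by move=> z zl; apply: sl; rewrite in_cons zl orbT.
have [cf2 [vw [h2 g2 s2 m2 v2]]] := av (sl _ (mem_head _ _)) g1.
exists cf2; split=> //; first exact: reachable_trans h1 h2.
  by move=> m /s1/s2.
move=> z; rewrite in_cons => /orP[/eqP->|/m1[vw' /s2 ? ?]]; first by exists vw.
by exists vw'.
Qed.

(** By [nZr] the messages read so far leave the view at zero on the variables still to be read, so
    every message on those can be loaded. *)
Lemma truns_reads mem (rv : valuation) rest :
  rv ord_max = ord0 ->
  (forall y, y \in rds -> exists2 vw, mem (y, ord0, vw) & vsub vw (Zr y)) ->
  exists (rv2 : valuation) vw2, [/\ rv2 ord_max = ord0, vsub vw2 Z &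
    forall mem3 lc3, truns mem (cseq rest, rv2, vw2) mem3 lc3 ->
      truns mem (cseq (map rd rds ++ rest), rv, view0 V) mem3 lc3].
Proof.
move=> hr hm.
have : forall y, y \in rds -> (view0 V) y = 0 by move=> y _; rewrite ffunE.
have : vsub (view0 V) Z by move=> y; rewrite ffunE.
suff H (l : seq V) (vw : view) (rv1 : valuation) : uniq l -> rv1 ord_max = ord0 ->
    {subset l <= rds} -> vsub vw Z -> (forall y, y \in l -> vw y = 0) ->
    exists (rv2 : valuation) vw2, [/\ rv2 ord_max = ord0, vsub vw2 Z &
    forall mem3 lc3, truns mem (cseq rest, rv2, vw2) mem3 lc3 ->
      truns mem (cseq (map rd l ++ rest), rv1, vw) mem3 lc3].
  by move=> *; apply: H.
elim: l vw rv1 => [|y l IH] vw {hr rv} rv ul hr sl vZ v0; first by exists rv, vw; split.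
have yr := sl _ (mem_head _ _).
have [vw1 m1 vZ1] := hm _ yr.
have [|rv1 [h1 hr1]] := truns_rd m1 hr (vw := vw); first by rewrite v0 ?mem_head.
have sl' : {subset l <= rds} by move=> z zl; apply: sl; rewrite in_cons zl orbT.
move: ul => /= /andP[yl ul].
have [|z zl|rv2 [vw2 [? ? h2]]] := IH (view_join vw vw1) rv1 ul hr1 sl'.
- move=> z; rewrite ffunE leq_max => /orP[/vZ//|/vZ1]; exact: sZr.
- rewrite ffunE v0 ?in_cons ?zl ?orbT // max0n.
  apply/eqP; rewrite -leqn0 leqNgt; apply/negP => /vZ1; apply: nZr => //.
    exact: sl'.
  by apply: contraNneq yl => ->.
exists rv2, vw2; split=> // mem4 [[c4 rv4] vw4] /h2 h4.
exact: truns_cons h1 h4.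
Qed.

Lemma thread_reaches_last (cf : config) : good cf ->
  exists cf1 mem2 (rv2 : valuation) vw2,
   [/\ reachable ord0 cf cf1, good cf1, mem_sub cf.1 mem2, good_mem mem2 &
    [/\ vsub vw2 Z, rv2 ord_max = ord0 &
     forall mem3 lc3, truns mem2 (cseq [:: com_last o], rv2, vw2) mem3 lc3 ->
       truns cf1.1 lc0 mem3 lc3]].
Proof.
move=> /avail_reads[cf1 [h1 g1 s1 hm]].
have [|rv1 [vw1 [hr1 vZ1 hrd]]] :=
  @truns_reads cf1.1 [ffun=> ord0] (map com_block blks ++ [:: com_last o]) _ hm.
  by rewrite ffunE.
have [mem2 [rv2 [vw2 [? s2 ? ? hb]]]] :=
  truns_blocks [:: com_last o] (proj1 g1) hr1 vZ1 okb.
exists cf1, mem2, rv2, vw2; split=> //; first by move=> m /s1/s2.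
split=> // mem3 lc3 /hb/hrd h3.
exact: truns_trans (truns_calt _ _ _ _ tp) h3.
Qed.

Lemma avail_thread x : o = Some x -> Z x -> avail x Z.
Proof.
move=> ox Zx cf /thread_reaches_last; rewrite ox.
move=> [cf1 [mem2 [rv2 [vw2 [h1 g1 s12 gm2 [vZ2 hr2 hl]]]]]].
have [mem3 [vw3 [h3 gm3 s3 vZ3 m3]]] := truns_pol gm2 hr2 vZ2 Zx.
have [|cf4 [t [h4 g4 e4 _]]] := @good_fresh_run cf1 mem3 (CSkip, rv2, vw3) g1 _ gm3.
  apply: hl; apply: truns_cons h3 _; exact: TrunsRefl.
exists cf4, vw3; rewrite e4; split=> //; first exact: reachable_trans h1 h4.
by move=> m /s12/s3.
Qed.

Lemma unsafe_thread : o = None -> unsafe ord0 ord_max (com_prog p).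
Proof.
move=> on.
have g0 : good (init_config ord0 ord_max (com_prog p)).
  split; last by exists 0.
  split; first by move=> x; exists x.
  by exists 0 => m [x ->] /=; rewrite ffunE.
have [cf1 [mem2 [rv2 [vw2 [h1 g1 s12 gm2 [vZ2 hr2 hl]]]]]] := thread_reaches_last g0.
have [cf4 [t [h4 _ _ e4]]] := good_fresh_run g1 (hl _ _ (TrunsRefl _ _)) gm2.
exists cf4, t; split; first exact: reachable_trans h1 h4.
by rewrite e4 on; apply: ExecSeq; apply: ExecAssert.
Qed.

End Thread.
End Reach.

End ViewPrograms.

(** * One-dimensional automata with a globally visible head cell *)

Section Automaton.
Variables (G : finType) (head_rule : G -> G -> G) (cell_rule : G -> G -> G -> G -> G)
  (left_of : G -> G).

Definition ca_step (e : nat) (A : nat -> G) (j : nat) : G :=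
  if j == 0 then head_rule (A 0) (A 1) else if j == e then A j else
  cell_rule (A 0) (if j == 1 then left_of (A 0) else A j.-1) (A j) (A j.+1).

Lemma eq_ca_step e A B : 0 < e -> (forall j, j <= e -> A j = B j) ->
  forall j, j <= e -> ca_step e A j = ca_step e B j.
Proof.
move=> e0 h j le; rewrite /ca_step.
case: eqP => [_|j0]; first by rewrite !h //.
case: eqP => [_|je]; first by rewrite h.
by rewrite !h //; lia.
Qed.

Lemma eq_iter_ca_step e A B n : 0 < e -> (forall j, j <= e -> A j = B j) ->
  forall j, j <= e -> iter n (ca_step e) A j = iter n (ca_step e) B j.
Proof. by move=> e0 h; elim: n => //= n IH; apply: eq_ca_step. Qed.

End Automaton.

(** * The parameterized system simulating an automaton *)

Section Reduction.
Variables (G : finType) (head_rule : G -> G -> G) (cell_rule : G -> G -> G -> G -> G)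
  (left_of : G -> G) (icell : option bool -> G) (acc : pred G) (X : nat).

Local Notation N := X.+3.
Local Notation step := (ca_step head_rule cell_rule left_of X.+2).

(* [(v, None)] is the variable that announces the pairs of copy [v];
   [(v, Some (e, g))] is polluted iff the source ([e = false]) or target
   ([e = true]) cell of the pair is not [g]. *)
Definition sel : Type := (bool * option (bool * G))%type.
Definition nsel : nat := #|{: sel}|.
Definition nvars : nat := X.+1 * N * nsel.

(** A mixed-radix number, so that for fixed [X] a shift of [i] or [j] adds a fixed amount and nested
    loops can print the index in unary. *)
Definition var_index (i j : nat) (s : sel) : nat := (i * N + j) * nsel + enum_rank s.

Definition var (i j : nat) (s : sel) : 'I_nvars.+1 := inord (var_index i j s).

Lemma var_index_lt i j s : i <= X -> j < N -> var_index i j s < nvars.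
Proof.
move=> iX jN; rewrite /var_index /nvars.
have : enum_rank s < nsel by apply: ltn_ord.
move: (nat_of_ord _) nsel => r S rS.
have : (i * N + j).+1 * S <= X.+1 * N * S by apply: leq_mul => //; nia.
lia.
Qed.

Lemma val_var i j s : i <= X -> j < N -> var i j s = var_index i j s :> nat.
Proof. by move=> iX jN; rewrite inordK // ltnS ltnW // var_index_lt. Qed.

Lemma var_inj i j s i' j' s' : i <= X -> i' <= X -> j < N -> j' < N ->
  var i j s = var i' j' s' -> [/\ i = i', j = j' & s = s'].
Proof.
move=> iX iX' jN jN' /(congr1 val) /=; rewrite !val_var // /var_index => e.
have r1 : enum_rank s < nsel by apply: ltn_ord.
have r2 : enum_rank s' < nsel by apply: ltn_ord.
have er : enum_rank s = enum_rank s' :> nat.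
  by have := congr1 (modn^~ nsel) e; rewrite !modnMDl !modn_small.
have n0 : 0 < nsel by apply: leq_ltn_trans r1.
have {}e : i * N + j = i' * N + j'.
  have := congr1 (divn^~ nsel) e; rewrite !divnMDl //.
  by rewrite !divn_small // !addn0.
have ej : j = j' by have := congr1 (modn^~ N) e; rewrite !modnMDl !modn_small.
split=> //; last by apply: enum_rank_inj; apply: val_inj.
by subst j'; move: e; nia.
Qed.

(* [(a, d, s)] stands, relative to [(i, j)], for [var (i + a) (j + d) s]. *)
Definition svar : Type := (nat * nat * sel)%type.
Definition inst_var (i j : nat) (x : svar) : 'I_nvars.+1 :=
  var (i + x.1.1) (j + x.1.2) x.2.
Definition inst_line (i j : nat) (ln : seq (bool * svar)) : line 'I_nvars.+1 :=
  [seq (a.1, inst_var i j a.2) | a <- ln].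
Definition inst (i j : nat) (b : seq (seq (bool * svar))) : block 'I_nvars.+1 :=
  map (inst_line i j) b.

(* Not [X.+3], so that [simpl] does not unroll the list. *)
Definition cells : seq nat := iota 0 (X + 3).

Lemma mem_cells j : (j \in cells) = (j < N).
Proof. by rewrite mem_iota add0n addn3. Qed.

Definition note (i : nat) (v : bool) := var i 0 (v, None).
Definition slot i (v e : bool) j g := var i j (v, Some (e, g)).

Definition others (f : G -> svar) (g : G) : seq (bool * svar) :=
  [seq (false, f g') | g' <- enum G & g' != g].

Definition con (v : bool) (c : bool * nat * G) : seq (bool * svar) :=
  others (fun g => (0, c.1.2, (v, Some (c.1.1, g)))) c.2.

Definition first_tile g0 a b : seq (bool * nat * G) :=
  [:: (false, 0, g0); (false, 1, a); (false, 2, b); (true, 0, head_rule g0 a);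
      (true, 1, cell_rule g0 (left_of g0) a b)].
Definition mid_tile g0 a b c : seq (bool * nat * G) :=
  [:: (false, 1, a); (false, 2, b); (false, 3, c); (true, 2, cell_rule g0 a b c)].
Definition last_tile (a : G) : seq (bool * nat * G) :=
  [:: (false, 2, a); (true, 2, a)].

Definition tile_line v cs := flatten (map (con v) cs).

Definition leaf_first v g0 :=
  [seq tile_line v (first_tile g0 p.1 p.2) | p <- enum {: G * G}].
Definition leaf_mid v g0 :=
  [seq tile_line v (mid_tile g0 p.1.1 p.1.2 p.2) | p <- enum {: G * G * G}].
Definition leaf_last v := [seq tile_line v (last_tile a) | a <- enum G].

(** The first tile determines target cells 0 and 1, the [X] middle ones the cells [j + 2], the last
    one cell [X + 2]: hence [X.+3] cells. Every middle tile depends on cell 0, so its symbol [g0] is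
    fixed for the whole thread and enforced once, by the first tile. *)
Definition leaf v g0 : thread 'I_nvars.+1 :=
  ([::], inst 0 0 (leaf_first v g0) ::
         [seq inst 0 j (leaf_mid v g0) | j <- iota 0 X] ++ [:: inst 0 X (leaf_last v)],
   Some (inst_var 0 0 (0, 0, (v, None)))).

Definition up_source v := [seq (true, (0, 0, (false, Some (false, g)))) ::
  others (fun g' => (1, 0, (v, Some (false, g')))) g | g <- enum G].
Definition up_middle : seq (seq (bool * svar)) :=
  [seq [:: (true, (0, 0, (false, Some (true, g))));
           (true, (0, 0, (true, Some (false, g))))] | g <- enum G].
Definition up_target v := [seq (true, (0, 0, (true, Some (true, g)))) ::
  others (fun g' => (1, 0, (v, Some (true, g')))) g | g <- enum G].

Definition up i v : thread 'I_nvars.+1 :=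
  ([:: inst_var i 0 (0, 0, (false, None)); inst_var i 0 (0, 0, (true, None))],
   flatten [seq [:: inst i j (up_source v); inst i j up_middle;
                    inst i j (up_target v)] | j <- cells],
   Some (inst_var i 0 (1, 0, (v, None)))).

Definition goal_source (o : option bool) : seq (seq (bool * svar)) :=
  [:: [:: (true, (0, 0, (false, Some (false, icell o))))]].
(** A target cell without a zero variable would make the claim of the message vacuous, so each must
    be seen to hold some symbol. *)
Definition goal_any : seq (seq (bool * svar)) :=
  [seq [:: (true, (0, 0, (false, Some (true, g))))] | g <- enum G].
Definition goal_target : seq (seq (bool * svar)) :=
  [seq [:: (true, (0, 0, (false, Some (true, g))))] | g <- enum G & acc g].

Definition input_at (w : seq bool) (j : nat) : option bool :=
  nth None (map Some w) j.

Definition goal (w : seq bool) : thread 'I_nvars.+1 :=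
  ([:: inst_var X 0 (0, 0, (false, None))],
   flatten [seq [:: inst X j (goal_source (input_at w j)); inst X j goal_any]
           | j <- cells] ++ [:: inst X 0 goal_target], None).

Definition prog (w : seq bool) : seq (thread 'I_nvars.+1) :=
  [seq leaf p.1 p.2 | p <- enum {: bool * G}] ++
  flatten [seq [:: up i false; up i true] | i <- iota 0 X] ++ [:: goal w].

Definition ca_init (w : seq bool) (j : nat) : G := icell (input_at w j).

Lemma others_in f g a : a \in others f g -> exists2 g', g' != g & a = (false, f g').
Proof. by case/mapP => g'; rewrite mem_filter => /andP[ne _] ->; exists g'. Qed.

Lemma in_others (f : G -> svar) g g' : g' != g -> (false, f g') \in others f g.
Proof. by move=> ne; apply: map_f; rewrite mem_filter ne mem_enum. Qed.

Lemma tile_line_in v cs a : a \in tile_line v cs ->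
  exists c g, [/\ c \in cs, g != c.2 & a = (false, (0, c.1.2, (v, Some (c.1.1, g))))].
Proof.
case/flatten_mapP => c cc /others_in[g ne ->]; by exists c, g.
Qed.

Lemma in_tile_line v cs c g : c \in cs -> g != c.2 ->
  (false, (0, c.1.2, (v, Some (c.1.1, g)))) \in tile_line v cs.
Proof.
move=> cc ne; apply/flatten_mapP; exists c => //.
exact: (in_others (fun g => (0, c.1.2, (v, Some (c.1.1, g))))).
Qed.

(** * Safety of the reduction *)

Section Sound.
Variables (w : seq bool).
Hypothesis nacc : ~~ acc (iter (2 ^ X) step (ca_init w) 0).

Definition pair_zero i v (A B : nat -> G) (vw : view 'I_nvars.+1) : Prop :=
  forall j, j < N -> vw (slot i v false j (A j)) = 0 /\ vw (slot i v true j (B j)) = 0.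

(** A larger view has fewer zeros and so satisfies fewer instances of [pair_zero]; this gives
    monotonicity and makes inconsistent guesses harmless. Only [note] variables carry a claim, which
    leaves stores to slots unconstrained. *)
Definition Inv (x : 'I_nvars.+1) (vw : view 'I_nvars.+1) : Prop :=
  forall i v, i <= X -> x = note i v -> forall A B, pair_zero i v A B vw ->
  forall j, j < N -> B j = iter (2 ^ i) step A j.

Lemma Inv_mono x v u : vle v u -> Inv x v -> Inv x u.
Proof.
move=> le h i b iX xe A B z; apply: (h i b) => // j jN.
have [z1 z2] := z j jN.
split; apply/eqP; rewrite -leqn0.
  by have := le (slot i b false j (A j)); rewrite z1.
by have := le (slot i b true j (B j)); rewrite z2.
Qed.

Lemma Inv_slot i j v s vw : i <= X -> j < N -> Inv (var i j (v, Some s)) vw.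
Proof. by move=> iX jN i' v' iX' /var_inj[]. Qed.

Lemma line_post_others i j f g vw0 vw g' ln :
  line_post (inst_line i j ln) vw0 vw -> {subset others f g <= ln} ->
  vw (inst_var i j (f g')) = 0 -> g' = g.
Proof.
move=> lp sub z; apply/eqP; apply: contra_eqT z => ne.
have := lp (false, inst_var i j (f g')) (map_f _ (sub _ (in_others f ne))).
by rewrite /= lt0n.
Qed.

Lemma line_post_tile j v cs vw0 vw A B c : pair_zero 0 v A B vw ->
  line_post (inst_line 0 j (tile_line v cs)) vw0 vw ->
  c \in cs -> j + c.1.2 < N -> (if c.1.1 then B else A) (j + c.1.2) = c.2.
Proof.
move=> z lp cc lt.
apply: (line_post_others (f := fun g => (0, c.1.2, (v, Some (c.1.1, g)))) lp).
  by move=> a /others_in[g ne ->]; apply: in_tile_line.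
have [z1 z2] := z _ lt.
by case: c.1.1.
Qed.

Lemma leaf_ok v g0 : thread_ok Inv (leaf v g0).
Proof.
split.
  have tile_ok : forall j cs a, (forall c, c \in cs -> j + c.1.2 < N) ->
      a \in inst_line 0 j (tile_line v cs) -> forall u, Inv a.2 u.
    move=> j cs a lt /mapP[b /tile_line_in[c [g [cc ne ->]]] -> /=] u.
    exact/Inv_slot/lt.
  move=> b ln a /=; rewrite in_cons mem_cat => /orP[/eqP->|/orP[]].
  - move=> /mapP[l /mapP[p _ ->] ->] h _; apply: tile_ok h => c.
    by rewrite !in_cons => /or4P[/eqP->|/eqP->|/eqP->|/orP[/eqP->|/orP[/eqP->|]]] //=; lia.
  - move=> /mapP[j]; rewrite mem_iota add0n => /andP[_ jX] ->.
    move=> /mapP[l /mapP[p _ ->] ->] h _; apply: tile_ok h => c.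
    by rewrite !in_cons => /or4P[/eqP->|/eqP->|/eqP->|/orP[/eqP->|]] //=; lia.
  - rewrite mem_seq1 => /eqP-> /mapP[l /mapP[p _ ->] ->] h _.
    apply: tile_ok h => c.
    by rewrite !in_cons => /or3P[/eqP->|/eqP->|] //=; lia.
move=> vw0 vw le _ /= hb i v' iX /var_inj[] // <- _ [<-] A B z.
have [|l /mapP[_ /mapP[[a b] _ ->] ->] /(line_post_tile z) H0] :=
  hb (inst 0 0 (leaf_first v g0)); first by rewrite mem_head.
have A0 : A 0 = g0 by apply: (H0 (false, 0, g0)); rewrite ?inE ?eqxx //; lia.
have A1 : A 1 = a by apply: (H0 (false, 1, a)); rewrite ?inE ?eqxx ?orbT //; lia.
have A2 : A 2 = b by apply: (H0 (false, 2, b)); rewrite ?inE ?eqxx ?orbT //; lia.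
move=> j jN; rewrite /= /ca_step.
case: (ltngtP j 1) => [j0|j1|->] //=.
- have -> : j = 0 by lia.
  rewrite A0 A1; apply: (H0 (true, 0, _)); rewrite ?inE ?eqxx ?orbT //; lia.
- rewrite gtn_eqF; last by lia.
  case: eqP => [->|jX].
    have [|l2 /mapP[_ /mapP[c _ ->] ->] /(line_post_tile z) H] :=
      hb (inst 0 X (leaf_last v)); first by rewrite in_cons mem_cat inE eqxx !orbT.
    have := H (true, 2, c); have := H (false, 2, c).
    by rewrite !inE ?eqxx ?orbT /= addn2 => -> // ->.
  (* The middle tile with target cell [j] is the one shifted by [j - 2]. *)
  have [|l2 /mapP[_ /mapP[[[c d] e] _ ->] ->] /(line_post_tile z) H] :=
      hb (inst 0 j.-2 (leaf_mid v g0)).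
    rewrite in_cons mem_cat (map_f (fun j => inst 0 j _)) ?orbT //.
    by rewrite mem_iota; lia.
  have := H (true, 2, cell_rule g0 c d e); rewrite !inE ?eqxx ?orbT /=.
  have := H (false, 1, c); rewrite !inE ?eqxx ?orbT /=.
  have := H (false, 2, d); rewrite !inE ?eqxx ?orbT /=.
  have := H (false, 3, e); rewrite !inE ?eqxx ?orbT /=.
  have -> : j.-2 + 1 = j.-1 by lia.
  have -> : j.-2 + 2 = j by lia.
  have -> : j.-2 + 3 = j.+1 by lia.
  move=> -> //; last by lia.
  move=> -> //; move=> -> //; last by lia.
  by move=> -> //; rewrite A0.
- rewrite A0 A1 A2; apply: (H0 (true, 1, _)); rewrite ?inE ?eqxx ?orbT //; lia.
Qed.

Lemma up_ok i v : i < X -> thread_ok Inv (up i v).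
Proof.
move=> iX; split.
  move=> b ln a /= /flatten_mapP[j]; rewrite mem_cells => jN.
  have others_ok : forall e g c, (i + 1 <= X) ->
      c \in inst_line i j (others (fun g' => (1, 0, (v, Some (e, g')))) g) ->
      forall u, Inv c.2 u.
    by move=> e g c le /mapP[d /others_in[g' _ ->] ->] u; apply: Inv_slot => /=; lia.
  rewrite !inE => /or3P[] /eqP-> /mapP[l /mapP[g _ ->] ->] /=; rewrite in_cons.
  - by move=> /orP[/eqP->//|h] _; apply: others_ok h; lia.
  - by rewrite inE => /orP[] /eqP->.
  - by move=> /orP[/eqP->//|h] _; apply: others_ok h; lia.
move=> vw0 vw le hr /= hb i' v' iX' /var_inj[] /=; rewrite ?addn0 ?addn1 //.
move=> e _ [<-] A C z; rewrite -{}e {i' v' iX'} in z *.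
have I0 := hr _ (mem_head _ _) i false (ltnW iX).
have I1 : Inv (note i true) vw0.
  have := hr (inst_var i 0 (0, 0, (true, None))).
  by rewrite in_cons inE eqxx orbT /inst_var !addn0; apply.
rewrite /inst_var !addn0 in I0; have {}I0 := I0 erefl.
have {}I1 := I1 i true (ltnW iX) erefl.
have blk : forall j b, j < N ->
    b \in [:: inst i j (up_source v); inst i j up_middle; inst i j (up_target v)] ->
    exists2 ln, ln \in b & line_post ln vw0 vw.
  move=> j b jN bin; apply: hb; apply/flatten_mapP; exists j => //.
  by rewrite mem_cells.
have hA : forall j, j < N -> vw0 (slot i false false j (A j)) = 0.
  move=> j jN; have [] := blk j (inst i j (up_source v)) jN; first by rewrite mem_head.
  move=> l /mapP[_ /mapP[g _ ->] ->] lp.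
  have -> : A j = g.
    apply: (line_post_others (f := fun g' => (1, 0, (v, Some (false, g')))) lp).
      by move=> a al; rewrite in_cons al orbT.
    by rewrite /inst_var /= addn0 addn1; have [] := z j jN.
  by have := lp _ (mem_head _ _); rewrite /= /inst_var /= !addn0.
have hC : forall j, j < N -> vw0 (slot i true true j (C j)) = 0.
  move=> j jN; have [] := blk j (inst i j (up_target v)) jN.
    by rewrite !inE eqxx !orbT.
  move=> l /mapP[_ /mapP[g _ ->] ->] lp.
  have -> : C j = g.
    apply: (line_post_others (f := fun g' => (1, 0, (v, Some (true, g')))) lp).
      by move=> a al; rewrite in_cons al orbT.
    by rewrite /inst_var /= addn0 addn1; have [] := z j jN.
  by have := lp _ (mem_head _ _); rewrite /= /inst_var /= !addn0.
(* The middle configuration is stored nowhere; it is recovered by picking at each cell a symbol that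
   is zero both as target of the first pair and as source of the second. The default can only be
   reached outside the window. *)
pose B j := odflt (A 0) [pick g | (vw0 (slot i false true j g) == 0) &&
                                  (vw0 (slot i true false j g) == 0)].
have hB : forall j, j < N -> vw0 (slot i false true j (B j)) = 0 /\
                             vw0 (slot i true false j (B j)) = 0.
  move=> j jN; have [] := blk j (inst i j up_middle) jN; first by rewrite !inE eqxx !orbT.
  move=> l /mapP[_ /mapP[g _ ->] ->] lp.
  rewrite /B; case: pickP => [h /andP[/eqP-> /eqP->] //|/(_ g)].
  have := lp _ (mem_head _ _); rewrite /= /inst_var /= !addn0 /slot => -> /=.
  have := lp (true, inst_var i j (0, 0, (true, Some (false, g)))).
  rewrite !inE eqxx orbT /inst_var /= !addn0 => -> //.
(* [B] is known to be the half-way configuration on the window only, which suffices by locality. *)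
move=> j jN; rewrite expnS mul2n -addnn iterD.
rewrite (I1 B C) //; last by move=> ? ?; split; [apply: (hB _ _).2|apply: hC].
apply: eq_iter_ca_step => // j' jN'.
by apply: I0 => // ? ?; split; [apply: hA|apply: (hB _ _).1].
Qed.

Lemma goal_ok : thread_ok Inv (goal w).
Proof.
split.
  move=> b ln a /=; rewrite mem_cat => /orP[/flatten_mapP[j _]|].
    rewrite !inE => /orP[] /eqP->; first by rewrite inE => /eqP->; rewrite inE => /eqP->.
    by move=> /mapP[l /mapP[g _ ->] ->]; rewrite inE => /eqP->.
  by rewrite inE => /eqP-> /mapP[l /mapP[g _ ->] ->]; rewrite inE => /eqP->.
move=> vw0 vw le hr /= hb.
have I0 := hr _ (mem_head _ _) X false (leqnn X).
rewrite /inst_var !addn0 in I0; have {}I0 := I0 erefl.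
have [|l /mapP[_ /mapP[g ga ->] ->] lp] := hb (inst X 0 goal_target).
  by rewrite mem_cat inE eqxx orbT.
have := lp _ (mem_head _ _); rewrite /= /inst_var /= !addn0 => zg {lp l}.
move: ga; rewrite mem_filter => /andP[ga _].
have blk : forall j b, j < N ->
    b \in [:: inst X j (goal_source (input_at w j)); inst X j goal_any] ->
    exists2 ln, ln \in b & line_post ln vw0 vw.
  move=> j b jN bin; apply: hb; rewrite mem_cat; apply/orP; left.
  by apply/flatten_mapP; exists j => //; rewrite mem_cells.
have hA : forall j, j < N -> vw0 (slot X false false j (ca_init w j)) = 0.
  move=> j jN; have [] := blk j _ jN (mem_head _ _).
  move=> l; rewrite inE => /eqP-> /(_ _ (mem_head _ _)).
  by rewrite /= /inst_var /= !addn0.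
(* Any selection of zero target symbols serves, provided cell 0 receives the accepting [g]: the
   claim identifies the selection with the true outcome, against [nacc]. *)
pose B j := if j == 0 then g else odflt g [pick g | vw0 (slot X false true j g) == 0].
have hB : forall j, j < N -> vw0 (slot X false true j (B j)) = 0.
  move=> j jN; rewrite /B; case: eqP => [->//|_]; case: pickP => [h /eqP//|].
  have [|l] := blk j (inst X j goal_any) jN; first by rewrite !inE eqxx orbT.
  move=> /mapP[_ /mapP[h _ ->] ->] /(_ _ (mem_head _ _)) /=.
  by rewrite /inst_var /= !addn0 /slot => zh /(_ h); rewrite zh.
move/negP: nacc; apply.
by rewrite -(I0 (ca_init w) B) // => j jN; split; [apply: hA|apply: hB].
Qed.

Lemma prog_safe : ~ unsafe ord0 ord_max (com_prog (prog w)).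
Proof.
apply: (safe_com_prog Inv_mono) => t; rewrite !mem_cat => /or3P[].
- by move=> /mapP[p _ ->]; apply: leaf_ok.
- move=> /flatten_mapP[i]; rewrite mem_iota add0n => /andP[_ iX].
  by rewrite !inE => /orP[] /eqP->; apply: up_ok.
- by rewrite inE => /eqP->; apply: goal_ok.
Qed.

End Sound.

(** * Completeness of the reduction *)

Section Complete.
Variables (w : seq bool).

Local Notation avail := (avail (prog w)).

Definition below (i : nat) (x : 'I_nvars.+1) : Prop :=
  exists i' j s, [/\ i' < i, j < N & x = var i' j s].

(** For [s = None] the last condition is vacuous, which admits the announcing variable: its own
    store raises it. *)
Definition off_pair i v (A B : nat -> G) (x : 'I_nvars.+1) : Prop :=
  exists j s, [/\ j < N, x = var i j (v, s) &
    forall e g, s = Some (e, g) -> g != (if e then B else A) j].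

(** Reading drags in the pollution of all lower levels. These are never consulted again, so their
    state need not be tracked. *)
Definition polluted i v A B x : Prop := below i x \/ off_pair i v A B x.

Lemma below_var i i' j s : i <= i' -> i' <= X -> j < N -> ~ below i (var i' j s).
Proof.
move=> le iX jN [i2 [j2 [s2 [lt jN2 /var_inj[]]]]] //; first by lia.
by move=> e _ _; move: lt; rewrite -e ltnNge le.
Qed.

Lemma off_pair_level i i' v A B j s :
  i <= X -> i' <= X -> j < N -> i != i' -> ~ off_pair i v A B (var i' j s).
Proof.
move=> iX iX' jN ne [j2 [s2 [jN2 /var_inj[] // e]]].
by rewrite e eqxx in ne.
Qed.

Lemma off_pair_copy i v v' A B j s :
  i <= X -> j < N -> v != v' -> ~ off_pair i v A B (var i j (v', s)).
Proof.
by move=> iX jN ne [j2 [s2 [jN2 /var_inj[] // _ _ [e]]]]; rewrite e eqxx in ne.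
Qed.

Lemma off_pair_slot i v A B j e :
  i <= X -> j < N -> ~ off_pair i v A B (slot i v e j ((if e then B else A) j)).
Proof.
move=> iX jN [j2 [s2 [jN2 /var_inj[] // _ <- [<-] /(_ _ _ erefl)]]].
by rewrite eqxx.
Qed.

Lemma off_pair_note i v A B : off_pair i v A B (note i v).
Proof. by exists 0, None. Qed.

Lemma off_pair_others i v A B j e g : j < N -> g != (if e then B else A) j ->
  off_pair i v A B (slot i v e j g).
Proof. by move=> jN ne; exists j, (Some (e, g)); split=> // e' g' [<- <-]. Qed.

Lemma line_ok_tile (Z : 'I_nvars.+1 -> Prop) v A B j cs :
  (forall x, off_pair 0 v A B x -> Z x) ->
  (forall c, c \in cs ->
     j + c.1.2 < N /\ c.2 = (if c.1.1 then B else A) (j + c.1.2)) ->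
  line_ok Z (inst_line 0 j (tile_line v cs)).
Proof.
move=> sZ h a /mapP[b /tile_line_in[c [g [cc ne ->]]] -> /=].
have [lt e] := h c cc; apply: sZ; apply: off_pair_others => //.
by rewrite -e.
Qed.

Lemma avail_leaf v A : avail (note 0 v) (polluted 0 v A (step A)).
Proof.
have lin : leaf v (A 0) \in prog w.
  by rewrite mem_cat (map_f (fun p => leaf p.1 p.2) (x := (v, A 0))) // mem_enum.
apply: (avail_thread (Zr := fun _ _ => False) lin) => //; last first.
  by right; apply: off_pair_note.
have tile_ok := @line_ok_tile (polluted 0 v A (step A)) v A (step A).
have {}tile_ok j cs := tile_ok j cs (fun x => @or_intror _ _).
move=> b; rewrite in_cons mem_cat => /orP[/eqP->|/orP[]].
- exists (inst_line 0 0 (tile_line v (first_tile (A 0) (A 1) (A 2)))).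
    apply: map_f; apply: (map_f (fun p => tile_line v (first_tile _ p.1 p.2))
      (x := (A 1, A 2))); exact: mem_enum.
  apply: tile_ok => c.
  rewrite !in_cons => /or4P[/eqP->|/eqP->|/eqP->|/orP[/eqP->|/orP[/eqP->|]]] //=.
- move=> /mapP[j]; rewrite mem_iota add0n => /andP[_ jX] ->.
  exists (inst_line 0 j (tile_line v (mid_tile (A 0) (A j.+1) (A j.+2) (A j.+3)))).
    apply: map_f; apply: (map_f (fun p => tile_line v (mid_tile _ p.1.1 p.1.2 p.2))
      (x := (A j.+1, A j.+2, A j.+3))); exact: mem_enum.
  apply: tile_ok => c.
  rewrite !in_cons => /or4P[/eqP->|/eqP->|/eqP->|/orP[/eqP->|//]] /=.
  + by rewrite addn1; split=> //; lia.
  + by rewrite addn2; split=> //; lia.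
  + by rewrite addn3; split=> //; lia.
  + rewrite addn2; split; first by lia.
    by rewrite /ca_step; case: eqP => // _; case: eqP => // e; exfalso; lia.
- rewrite mem_seq1 => /eqP->.
  exists (inst_line 0 X (tile_line v (last_tile (A X.+2)))).
    by apply: map_f; apply: map_f; exact: mem_enum.
  apply: tile_ok => c; rewrite !in_cons => /or3P[/eqP->|/eqP->|//] /=.
    by rewrite addn2.
  by rewrite addn2 /ca_step eqxx.
Qed.

Lemma avail_up i : i < X ->
  (forall v A, avail (note i v) (polluted i v A (iter (2 ^ i) step A))) ->
  forall v A, avail (note i.+1 v) (polluted i.+1 v A (iter (2 ^ i.+1) step A)).
Proof.
move=> iX IH v A; set C := iter (2 ^ i.+1) step A.
pose B := iter (2 ^ i) step A.
have CE : C = iter (2 ^ i) step B by rewrite /C expnS mul2n -addnn iterD.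
(* What comes in with either message, together with the thread's own pollution one level up. *)
pose Z x := [\/ polluted i false A B x, polluted i true B C x
              | off_pair i.+1 v A C x].
pose Zr y := if y == note i false then polluted i false A B else polluted i true B C.
have nft : note i false != note i true.
  by apply/eqP => /var_inj[]//; rewrite ltnW.
have uin : up i v \in prog w.
  rewrite mem_cat mem_cat; apply/orP; right; apply/orP; left.
  apply/flatten_mapP; exists i; first by rewrite mem_iota.
  by case: (v); rewrite !inE eqxx ?orbT.
have iX' := ltnW iX.
apply: (avail_mono (Z := Z)).
  move=> x [] [] h; try by right.
  - by left; case: h => i' [j [s [lt jN ->]]]; exists i', j, s; split=> //; lia.
  - by left; case: h => j [s [jN -> _]]; exists i, j, (false, s).
  - by left; case: h => i' [j [s [lt jN ->]]]; exists i', j, s; split=> //; lia.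
  - by left; case: h => j [s [jN -> _]]; exists i, j, (true, s).
  - by move=> h'; right; exists h.
apply: (avail_thread (Zr := Zr) uin).
- by rewrite /= /inst_var !addn0 andbT inE.
- move=> y; rewrite !inE /inst_var /= !addn0 => /orP[] /eqP->.
    by rewrite /Zr eqxx; apply: IH.
  by rewrite /Zr eq_sym (negPf nft) CE; apply: IH.
- move=> y z _; rewrite /Zr; case: ifP => _ h; [exact: Or31|exact: Or32].
(* Neither message raises the announcing variable of the other: that variable is not on a lower
   level, and it belongs to the other copy. *)
- move=> y z; rewrite !inE /inst_var /= !addn0 => /orP[] /eqP-> /orP[] /eqP->;
    rewrite ?eqxx // => _; rewrite /Zr ?eqxx 1?eq_sym ?(negPf nft) => -[].
  + exact: below_var.
  + exact: off_pair_copy.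
  + exact: below_var.
  + exact: off_pair_copy.
- have nZ : forall j s, j < N -> ~ polluted i false A B (var i j s) ->
      ~ polluted i true B C (var i j s) -> ~ Z (var i j s).
    by move=> j s jN h1 h2 [] //; apply: off_pair_level => //; lia.
  have nZf : forall j e, j < N -> ~ Z (slot i false e j ((if e then B else A) j)).
    move=> j e jN; apply: nZ => // -[]; try exact: below_var.
      exact: off_pair_slot.
    exact: off_pair_copy.
  have nZt : forall j e, j < N -> ~ Z (slot i true e j ((if e then C else B) j)).
    move=> j e jN; apply: nZ => // -[]; try exact: below_var.
      exact: off_pair_copy.
    exact: off_pair_slot.
  have oZ : forall j e g a, j < N -> g = (if e then C else A) j ->
      a \in inst_line i j (others (fun g' => (1, 0, (v, Some (e, g')))) g) ->
      if a.1 then ~ Z a.2 else Z a.2.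
    move=> j e g a jN -> /mapP[b /others_in[g' ne ->] -> /=].
    by rewrite /inst_var /= addn0 addn1; apply: Or33; apply: off_pair_others.
  move=> b /flatten_mapP[j]; rewrite mem_cells => jN.
  rewrite !inE => /or3P[] /eqP->.
  + eexists; first by apply: map_f; apply: (map_f _ (x := A j)); exact: mem_enum.
    move=> a; rewrite in_cons => /orP[/eqP->|]; last exact: oZ.
    by rewrite /= /inst_var /= !addn0; apply: (nZf j false).
  + eexists; first by apply: map_f; apply: (map_f _ (x := B j)); exact: mem_enum.
    move=> a; rewrite !inE => /orP[] /eqP-> /=; rewrite /inst_var /= !addn0.
      exact: (nZf j true).
    exact: (nZt j false).
  + eexists; first by apply: map_f; apply: (map_f _ (x := C j)); exact: mem_enum.
    move=> a; rewrite in_cons => /orP[/eqP->|]; last exact: oZ.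
    by rewrite /= /inst_var /= !addn0; apply: (nZt j true).
- by rewrite /inst_var addn0 addn1.
- exact/Or33/off_pair_note.
Qed.

Lemma avail_pair i v A : i <= X ->
  avail (note i v) (polluted i v A (iter (2 ^ i) step A)).
Proof.
elim: i v A => [|i IH] v A iX; first exact: avail_leaf.
by apply: avail_up => // v' A'; apply: IH; apply: ltnW.
Qed.

Lemma prog_unsafe :
  acc (iter (2 ^ X) step (ca_init w) 0) -> unsafe ord0 ord_max (com_prog (prog w)).
Proof.
set A := ca_init w; set B := iter _ _ _ => accB.
have gin : goal w \in prog w by rewrite !mem_cat inE eqxx !orbT.
pose Z := polluted X false A B.
have nZ : forall j e, j < N -> ~ Z (slot X false e j ((if e then B else A) j)).
  by move=> j e jN []; [apply: below_var|apply: off_pair_slot].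
apply: (unsafe_thread (Zr := fun _ => Z) (Z := Z) gin) => //.
- by move=> y; rewrite inE /inst_var !addn0 => /eqP->; apply: avail_pair.
- by move=> y z; rewrite !inE => /eqP-> /eqP->; rewrite eqxx.
move=> b; rewrite mem_cat => /orP[/flatten_mapP[j]|].
  rewrite mem_cells !inE => jN /orP[] /eqP->.
    eexists; first exact: mem_head.
    by move=> a; rewrite inE => /eqP-> /=; rewrite /inst_var /= !addn0; apply: (nZ j false).
  eexists; first by apply: map_f; apply: (map_f _ (x := B j)); exact: mem_enum.
  by move=> a; rewrite inE => /eqP-> /=; rewrite /inst_var /= !addn0; apply: (nZ j true).
rewrite inE => /eqP->.
eexists.
  by apply: map_f; apply: (map_f _ (x := B 0)); rewrite mem_filter accB mem_enum.
by move=> a; rewrite inE => /eqP-> /=; rewrite /inst_var /= !addn0; apply: (nZ 0 true).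
Qed.

End Complete.

Theorem prog_correct w : unsafe ord0 ord_max (com_prog (prog w)) <->
  acc (iter (2 ^ X) step (ca_init w) 0).
Proof.
split; last exact: prog_unsafe.
by move=> h; apply: contraT => /prog_safe.
Qed.

End Reduction.

(** * Turing machines as automata *)

Section Machine.
Variables (k : nat) (M : TM k).

(* Cell [0] holds the state and the scanned symbols (as second components);
   cell [j.+1] holds, for every tape, the symbols at distance [j.+1] to the left
   and to the right of the head. *)
Definition cell : Type :=
  (tm_state M * {ffun 'I_k.+1 -> symbol (tm_aux M) * symbol (tm_aux M)})%type.

Definition cell_of (c : tm_config M) (j : nat) : cell :=
  if j is j'.+1
  then (tm_start M, [ffun i => (nth None (c.2 i).1.1 j', nth None (c.2 i).2 j')])
  else (c.1, [ffun i => (None, tape_read (c.2 i))]).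

Definition action (g : cell) := tm_delta g.1 [ffun i => (g.2 i).2].

Definition head_rule (g a : cell) : cell :=
  if tm_halted g.1 then g else
  ((action g).1, [ffun i => (None, match ((action g).2 i).2 with
                                   | MLeft => (a.2 i).1
                                   | MStay => ((action g).2 i).1
                                   | MRight => (a.2 i).2 end)]).

(** The symbol just written acts as the cell at distance 0 on both sides; a move sends it to
    distance 1 on the opposite side. *)
Definition left_of (g : cell) : cell :=
  (tm_start M, [ffun i => (((action g).2 i).1, ((action g).2 i).1)]).

Definition cell_rule (g a b c : cell) : cell :=
  if tm_halted g.1 then b else
  (b.1, [ffun i => match ((action g).2 i).2 with
                   | MLeft => ((c.2 i).1, (a.2 i).2)
                   | MStay => b.2 i
                   | MRight => ((a.2 i).1, (c.2 i).2) end]).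

Definition icell (o : option bool) : cell :=
  (tm_start M, [ffun i => (None, if i == ord0 then omap inl o else None)]).

Local Notation step := (ca_step head_rule cell_rule left_of).

(** Positions are relative to the heads, so a move shifts a whole tape at once; this is why each
    cell must know the action, which cell 0 determines. *)
Lemma cell_of_step e (c : tm_config M) :
  (forall i, tape_space (c.2 i) <= e) ->
  (forall i, tape_space ((tm_step c).2 i) <= e) ->
  forall j, j <= e -> cell_of (tm_step c) j = step e (cell_of c) j.
Proof.
move=> h1 h2.
have act0 : action (cell_of c 0) = tm_delta c.1 [ffun i => tape_read (c.2 i)].
  by rewrite /action /=; congr tm_delta; apply/ffunP => i; rewrite !ffunE.
move=> j le.
(* The space bound counts the scanned cell too, so at distance [e] every tape is blank before and
   after the step: freezing the border is correct. *)
have hl : j = e -> cell_of (tm_step c) j = cell_of c j.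
  have e0 : 0 < e by apply: leq_trans (h1 ord0); rewrite /tape_space addn1 addSn.
  move=> je; case: j je {le} => [je|j je]; first by rewrite -je in e0.
  congr (_, _); apply/ffunP => i; rewrite !ffunE.
  move: (h1 i) (h2 i); rewrite -je.
  move: (c.2 i) ((tm_step c).2 i) => [[l a] r] [[l' a'] r'].
  rewrite /tape_space /= !addn1 !addSn !ltnS => s1 s2.
  rewrite !nth_default //; first [exact: leq_trans (leq_addr _ _) s1
    | exact: leq_trans (leq_addl _ _) s1 | exact: leq_trans (leq_addr _ _) s2
    | exact: leq_trans (leq_addl _ _) s2].
rewrite /ca_step; case: eqP => [{hl le} ->|j0].
  rewrite /head_rule act0 /= /tm_step; case: ifP => // _.
  case: (tm_delta _ _) => q act /=; congr (_, _); apply/ffunP => i; rewrite !ffunE.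
  by congr (_, _); case: (c.2 i) => -[l a] r; case: (act i) => s [] /=;
    rewrite ?nth0 ?ffunE.
case: eqP => [|_]; first exact: hl.
rewrite /cell_rule /=; case hh : (tm_halted c.1).
  by rewrite /tm_step hh.
case: j j0 {le hl} => // j _; congr (_, _); apply/ffunP => i.
rewrite ffunE [RHS]ffunE act0 /tm_step hh.
case E : (tm_delta _ _) => [q act] /=; rewrite ffunE.
case: j => [|j] /=; rewrite !ffunE ?act0 ?E /=;
  by case: (c.2 i) => -[l a] r; case: (act i) => s [] /=; rewrite ?nth_behead.
Qed.

Variables (w : seq bool) (P : nat).
Hypothesis hP : forall t, tm_space (tm_run M w t) <= P.

Local Notation init := (ca_init icell w).

Lemma cell_of_init j : cell_of (tm_init M w) j = init j.
Proof.
have E j' : nth None [seq Some (inl b) | b <- w] j' =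
            omap inl (input_at w j') :> symbol (tm_aux M).
  rewrite /input_at; elim: w j' => [|b u IH] [|j'] //=; exact: IH.
case: j => [|j]; congr (_, _); apply/ffunP => i; rewrite !ffunE /=.
  by case: eqP => //= _; rewrite -E nth0.
by rewrite nth_nil; case: eqP => //= _; rewrite ?nth_behead ?E ?nth_nil.
Qed.

Lemma tm_tape_space t i : tape_space ((tm_run M w t).2 i) <= P.
Proof.
by apply: leq_trans (hP t); rewrite /tm_space (bigD1 i) //= leq_addr.
Qed.

Lemma cell_of_run e t j : P <= e -> j <= e ->
  cell_of (tm_run M w t) j = iter t (step e) init j.
Proof.
move=> Pe; have hs t' i : tape_space ((tm_run M w t').2 i) <= e.
  exact: leq_trans (tm_tape_space _ _) Pe.
have e0 : 0 < e by apply: leq_trans (hs 0 ord0); rewrite /tape_space addn1 addSn.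
elim: t j => [|t IH] j je; first exact: cell_of_init.
rewrite /tm_run iterS (cell_of_step (hs t) (hs t.+1)) //.
exact: eq_ca_step.
Qed.

Lemma tm_run_halted t t' : tm_halted (tm_run M w t).1 -> t <= t' ->
  tm_run M w t' = tm_run M w t.
Proof.
move=> h le; rewrite -(subnKC le); elim: (t' - t) => [|n IH]; first by rewrite addn0.
by rewrite addnS /tm_run iterS -/(tm_run M w _) IH /tm_step h.
Qed.

(* The run cannot visit the same configuration twice before it halts. *)
Lemma tm_run_halts_by t T : tm_halted (tm_run M w t).1 ->
  #|{: cell}| ^ P.+1 <= T -> tm_halted (tm_run M w T).1.
Proof.
move=> ht leT.
have ex : exists n, tm_halted (tm_run M w n).1 by exists t.
case: (ex_minnP ex) => n hn nmin {t ht ex}.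
case: (leqP n T) => [nT|Tn]; first by rewrite (tm_run_halted hn nT).
pose f (i : 'I_T.+1) : {ffun 'I_P.+1 -> cell} :=
  [ffun j : 'I_P.+1 => cell_of (tm_run M w i) j].
have : ~~ injectiveb f.
  apply/negP => /injectiveP /leq_card; rewrite card_ord card_ffun card_ord.
  by move=> h; have := leq_trans h leT; rewrite ltnn.
move=> /injectivePn[i [j ne ef]].
have : (i < j) || (j < i) by rewrite -neq_ltn.
wlog ij : i j ne ef / i < j.
  move=> H /orP[] lt; first by apply: (H i j) => //; rewrite lt.
  by apply: (H j i) => //; rewrite ?lt // eq_sym.
move=> _.
have e0 : 0 < P by apply: leq_trans (tm_tape_space 0 ord0); rewrite /tape_space addn1 addSn.
have jT : j <= T by rewrite -ltnS.
(* Equal windows stay equal, so the segment between the two visits can be cut out of the run,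
   against the minimality of [n]. *)
have shift m : forall l, l <= P ->
    cell_of (tm_run M w (m + i)) l = cell_of (tm_run M w (m + j)) l.
  move=> l lP; rewrite !(cell_of_run _ (leqnn P) lP) !iterD.
  apply: eq_iter_ca_step => // l' l'P.
  rewrite -!(cell_of_run _ (leqnn P) l'P).
  by move/ffunP/(_ (Ordinal (l'P : l' < P.+1))): ef; rewrite !ffunE.
have /(congr1 fst) /= := shift (n - j) 0 (leq0n P).
rewrite subnK; last by lia.
move=> e; have /nmin : tm_halted (tm_run M w (n - j + i)).1 by rewrite e.
lia.
Qed.

Theorem tm_accepting_ca X t : tm_halted (tm_run M w t).1 -> P <= X ->
  #|{: cell}| * P.+1 <= X ->
  tm_accepting (tm_run M w t).1 = tm_accepting (iter (2 ^ X) (step X.+2) init 0).1.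
Proof.
move=> ht PX cX; rewrite -(@cell_of_run X.+2) //; last by lia.
suff -> : (tm_run M w t).1 = (tm_run M w (2 ^ X)).1 by [].
have hX : tm_halted (tm_run M w (2 ^ X)).1.
  apply: tm_run_halts_by ht _.
  (* The number of window contents is below [2 ^ X] because a cardinality [c] is less than
     [2 ^ c]. *)
  apply: leq_trans (_ : (2 ^ #|{: cell}|) ^ P.+1 <= _).
    by rewrite leq_exp2r // ltnW // ltn_expl.
  by rewrite -expnM leq_pexp2l.
by case: (leqP t (2 ^ X)) => le; [rewrite (tm_run_halted ht le)|
  rewrite (tm_run_halted hX (ltnW le))].
Qed.

End Machine.

(** * Structured Turing machine programs *)

Section Structured.
Variable k : nat.

Local Notation sym := (symbol void).
Local Notation index := 'I_k.+1.
Definition tapes : Type := {ffun 'I_k.+1 -> tape void}.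
Definition reads : Type := {ffun 'I_k.+1 -> sym}.
Definition acts : Type := {ffun 'I_k.+1 -> sym * move}.

Inductive stm :=
| Act of index & (sym -> sym * move)
| Sq of stm & stm
| Wh of index & pred sym & stm
| Br of index & pred sym & stm & stm.

(** For a loop or a branch, [None] is the state that performs the test. *)
Fixpoint st (P : stm) : finType :=
  match P with
  | Act _ _ => unit
  | Sq P Q => (st P + st Q)%type
  | Wh _ _ P => option (st P)
  | Br _ _ P Q => option (st P + st Q)
  end.

Fixpoint st0 (P : stm) : st P :=
  match P with
  | Act _ _ => tt
  | Sq P Q => inl (st0 P)
  | Wh _ _ P => None
  | Br _ _ P Q => None
  end.

Definition keep (r : reads) : acts := [ffun i => (r i, MStay)].

(* Leaving the program is signalled by [None]. *)
Fixpoint delta (P : stm) : st P -> reads -> option (st P) * acts :=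
  match P return st P -> reads -> option (st P) * acts with
  | Act i f => fun _ r =>
      (None, [ffun j => if j == i then f (r i) else (r j, MStay)])
  | Sq P Q => fun s r =>
      match s with
      | inl s => let: (o, a) := delta s r in
                 (Some (if o is Some s' then inl s' else inr (st0 Q)), a)
      | inr s => let: (o, a) := delta s r in (omap inr o, a)
      end
  | Wh i p P => fun s r =>
      match s with
      | None => (if p (r i) then Some (Some (st0 P)) else None, keep r)
      | Some s => let: (o, a) := delta s r in (Some o, a)
      end
  | Br i p P Q => fun s r =>
      match s with
      | None => (Some (Some (if p (r i) then inl (st0 P) else inr (st0 Q))), keep r)
      | Some (inl s) => let: (o, a) := delta s r in
                        (omap (fun s' => Some (inl s')) o, a)
      | Some (inr s) => let: (o, a) := delta s r in
                        (omap (fun s' => Some (inr s')) o, a)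
      end
  end.

Definition read_all (T : tapes) : reads := [ffun i => tape_read (T i)].
Definition do_acts (a : acts) (T : tapes) : tapes :=
  [ffun i => tape_move (a i).2 (tape_write (a i).1 (T i))].

Definition nstep P (s : st P) (T : tapes) : option (st P) * tapes :=
  ((delta s (read_all T)).1, do_acts (delta s (read_all T)).2 T).

Inductive goes P : nat -> st P -> tapes -> option (st P) -> tapes -> Prop :=
| Goes1 s T o T' : nstep s T = (o, T') -> goes 1 s T o T'
| GoesS n s T s' T' o T'' :
    nstep s T = (Some s', T') -> goes n s' T' o T'' -> goes n.+1 s T o T''.

Definition tri P (T T' : tapes) (n : nat) : Prop :=
  exists2 m, m <= n & goes m (st0 P) T None T'.

Lemma goes_cat P n m (s s' : st P) T T' o T'' :
  goes n s T (Some s') T' -> goes m s' T' o T'' -> goes (n + m) s T o T''.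
Proof.
move=> h; move: {-1}(Some s') (erefl (Some s')) h => o' e h.
elim: h e => {n s T o' T'} [s T o' T' h e|n s T s1 T1 o' T' h _ IH e] h2.
  by subst o'; apply: GoesS h h2.
exact: GoesS h (IH e h2).
Qed.

Lemma do_keep T : do_acts (keep (read_all T)) T = T.
Proof. by apply/ffunP => i; rewrite !ffunE /=; case: (T i) => -[]. Qed.

(** [fo] also says where leaving the component leads: to the second part of a sequence, back to the
    test of a loop, or out of the whole program. *)
Lemma goes_embed P Q (f : st P -> st Q) (fo : option (st P) -> option (st Q)) :
  (forall s, fo (Some s) = Some (f s)) ->
  (forall s T, nstep (f s) T = (fo (nstep s T).1, (nstep s T).2)) ->
  forall n s T o T', goes n s T o T' -> goes n (f s) T (fo o) T'.
Proof.
move=> hf hs n s T o T'; elim=> {n s T o T'} [s T o T' h|n s T s1 T1 o T' h _ IH].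
  by apply: Goes1; rewrite hs h.
by apply: GoesS IH; rewrite hs h /= hf.
Qed.

Lemma goes_seql P Q n (s : st P) T o T' : goes n s T o T' ->
  @goes (Sq P Q) n (inl s) T (Some (if o is Some s' then inl s' else inr (st0 Q))) T'.
Proof.
apply: (@goes_embed P (Sq P Q) inl
  (fun o => Some (if o is Some s' then inl s' else inr (st0 Q)))) => // {}s {}T.
by rewrite /nstep /=; case: (delta _ _).
Qed.

Lemma goes_seqr P Q n (s : st Q) T o T' : goes n s T o T' ->
  @goes (Sq P Q) n (inr s) T (omap inr o) T'.
Proof.
apply: (@goes_embed Q (Sq P Q) inr (omap inr)) => // {}s {}T.
by rewrite /nstep /=; case: (delta _ _).
Qed.

Lemma goes_wh i p P n (s : st P) T o T' : goes n s T o T' ->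
  @goes (Wh i p P) n (Some s) T (Some o) T'.
Proof.
apply: (@goes_embed P (Wh i p P) some (fun o => Some o)) => // {}s {}T.
by rewrite /nstep /=; case: (delta _ _).
Qed.

Lemma goes_brl i p P Q n (s : st P) T o T' : goes n s T o T' ->
  @goes (Br i p P Q) n (Some (inl s)) T (omap (fun s' => Some (inl s')) o) T'.
Proof.
apply: (@goes_embed P (Br i p P Q) (fun s => Some (inl s))
   (omap (fun s' => Some (inl s')))) => // {}s {}T.
by rewrite /nstep /=; case: (delta _ _).
Qed.

Lemma goes_brr i p P Q n (s : st Q) T o T' : goes n s T o T' ->
  @goes (Br i p P Q) n (Some (inr s)) T (omap (fun s' => Some (inr s')) o) T'.
Proof.
apply: (@goes_embed Q (Br i p P Q) (fun s => Some (inr s))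
   (omap (fun s' => Some (inr s')))) => // {}s {}T.
by rewrite /nstep /=; case: (delta _ _).
Qed.

Lemma tri_le P T T' n m : tri P T T' n -> n <= m -> tri P T T' m.
Proof. by move=> [l le h] nm; exists l => //; apply: leq_trans le nm. Qed.

Definition act_tape (f : sym -> sym * move) (t : tape void) : tape void :=
  tape_move (f (tape_read t)).2 (tape_write (f (tape_read t)).1 t).

Lemma tri_act i f T : tri (Act i f) T (upd T i (act_tape f (T i))) 1.
Proof.
exists 1 => //; apply: Goes1; congr (_, _); apply/ffunP => j; rewrite !ffunE /=.
case: eqP => [->|_]; rewrite ?ffunE //=.
by case: (T j) => -[].
Qed.

Lemma tri_seq P Q T T1 T2 n1 n2 :
  tri P T T1 n1 -> tri Q T1 T2 n2 -> tri (Sq P Q) T T2 (n1 + n2).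
Proof.
move=> [m1 le1 h1] [m2 le2 h2]; exists (m1 + m2); first exact: leq_add.
exact: goes_cat (goes_seql Q h1) (goes_seqr P h2).
Qed.

Lemma tri_wh0 i (p : pred sym) P (T : tapes) : p (tape_read (T i)) = false -> tri (Wh i p P) T T 1.
Proof.
move=> hp; exists 1 => //; apply: Goes1.
by rewrite /nstep /= do_keep ffunE hp.
Qed.

Lemma tri_whS i (p : pred sym) P (T T1 T2 : tapes) n1 n2 : p (tape_read (T i)) ->
  tri P T T1 n1 -> tri (Wh i p P) T1 T2 n2 -> tri (Wh i p P) T T2 (n1 + n2).+1.
Proof.
move=> hp [m1 le1 h1] [m2 le2 h2]; exists (m1 + m2).+1.
  by rewrite ltnS leq_add.
apply: (@GoesS (Wh i p P) _ _ _ (Some (st0 P)) T).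
  by rewrite /nstep /= do_keep ffunE hp.
exact: goes_cat (goes_wh i p h1) h2.
Qed.

Lemma tri_br i (p : pred sym) P Q (T T1 : tapes) n :
  tri (if p (tape_read (T i)) then P else Q) T T1 n -> tri (Br i p P Q) T T1 n.+1.
Proof.
move=> [m le h]; exists m.+1 => //.
apply: (@GoesS (Br i p P Q) _ _ _ (Some (if p (tape_read (T i)) then inl (st0 P)
                              else inr (st0 Q))) T).
  by rewrite /nstep /= do_keep ffunE.
by case: (p _) h => h; [apply: (goes_brl _ _ _ h)|apply: (goes_brr _ _ _ h)].
Qed.

Definition stm_tm (P : stm) : TM k :=
  @MkTM k (option (st P)) void (Some (st0 P)) (fun o => ~~ o) pred0
    (fun o r => if o is Some s then delta s r else (None, keep r)).

Lemma tri_tm_run P w T n : tri P (tm_init (stm_tm P) w).2 T n ->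
  exists2 t, t <= n & tm_run (stm_tm P) w t = (None, T).
Proof.
move=> [m le h]; exists m => //; rewrite /tm_run.
suff gen s T0 o T1 : goes m s T0 o T1 ->
    iter m (@tm_step _ (stm_tm P)) (Some s, T0) = (o, T1) by exact: gen h.
elim=> {m le h s T0 o T1} [s T0 o T1 h|m s T0 s' T1 o T2 h _ IH].
  by case: h => <- <-; rewrite /= /tm_step /nstep /=; case: (delta _ _).
rewrite iterSr -IH; congr iter; case: h; rewrite /tm_step /=.
by rewrite /read_all /do_acts; case: (delta _ _) => o' a /= -> ->.
Qed.

End Structured.

(** * Counters, input and output *)

Section Counters.
Variables (k : nat) (w : seq bool).

Local Notation sym := (symbol void).
Local Notation index := 'I_k.+1.
Local Notation tapes := (tapes k).
Local Notation stm := (stm k).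

Definition mark : sym := Some (inl true).
Definition nonblank : pred sym := isSome.

(* A counter tape is scanned at the blank that follows its marks. *)
Definition ctr (n : nat) (t : tape void) : Prop :=
  exists u v, t = (nseq n mark ++ nseq u None, None, nseq v None).

Definition inp (pos : nat) (t : tape void) : Prop :=
  exists2 s : seq sym, pos < size s /\ (forall j, nth None s j = omap inl (input_at w j))
    & t = (rev (take pos s), nth None s pos, drop pos.+1 s).

Definition otape (out : seq bool) : tape void :=
  (rev [seq Some (inl b) | b <- out], None, [::]).

Definition env : Type := {ffun index -> nat}.
Definition state : Type := (env * nat * seq bool)%type.

Definition rep (D : {set index}) (s : state) (T : tapes) : Prop :=
  [/\ ord0 \notin D, ord_max \notin D, inp s.1.2 (T ord0), T ord_max = otape s.2
    & forall c, c \in D -> ctr (s.1.1 c) (T c)].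

Definition frame (D : {set index}) (T T' : tapes) : Prop :=
  forall c, c \notin D -> c != ord0 -> c != ord_max -> T' c = T c.

(** The frame condition protects tapes outside [D] that are in no counter format, such as that of an
    enclosing loop in mid-scan. *)
Definition hoare (D : {set index}) (P : stm) (s s' : state) (n : nat) : Prop :=
  ord0 != ord_max :> index ->
  forall T, rep D s T -> exists T', [/\ tri P T T' n, rep D s' T' & frame D T T'].

Lemma upd_same (I : finType) (U : Type) (f : {ffun I -> U}) i a : upd f i a i = a.
Proof. by rewrite ffunE eqxx. Qed.

Lemma upd_neq (I : finType) (U : Type) (f : {ffun I -> U}) i a j :
  j != i -> upd f i a j = f j.
Proof. by rewrite ffunE => /negPf->. Qed.

Lemma hoare_le (D : {set index}) P s s' n m : hoare D P s s' n -> n <= m -> hoare D P s s' m.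
Proof.
move=> h le ne T /(h ne)[T' [h1 h2 h3]]; exists T'; split=> //; exact: tri_le h1 le.
Qed.

Lemma hoare_seq (D : {set index}) P Q s s1 s2 n1 n2 : hoare D P s s1 n1 -> hoare D Q s1 s2 n2 ->
  hoare D (Sq P Q) s s2 (n1 + n2).
Proof.
move=> hP hQ ne T /(hP ne)[T1 [h1 r1 f1]]; have [T2 [h2 r2 f2]] := hQ ne _ r1.
exists T2; split=> //; first exact: tri_seq h1 h2.
by move=> c *; rewrite f2 // f1.
Qed.

Lemma tri_wh_act i (p : pred sym) f (t : nat -> tape void) n (T : tapes) :
  T i = t 0 -> (forall m, m < n -> p (tape_read (t m))) ->
  p (tape_read (t n)) = false -> (forall m, m < n -> act_tape f (t m) = t m.+1) ->
  tri (Wh i p (Act i f)) T (upd T i (t n)) (2 * n + 1).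
Proof.
elim: n t T => [|n IH] t T T0 hp hn hf.
  have -> : upd T i (t 0) = T by apply/ffunP => j; rewrite ffunE; case: eqP => // ->.
  by apply: tri_wh0; rewrite T0.
have -> : 2 * n.+1 + 1 = (1 + (2 * n + 1)).+1 by lia.
apply: tri_whS (tri_act _ _ _) _; first by rewrite T0; apply: hp.
have -> : upd T i (t n.+1) = upd (upd T i (act_tape f (T i))) i (t n.+1).
  by apply/ffunP => j; rewrite !ffunE; case: eqP.
apply: (IH (fun m => t m.+1)) => //.
- by rewrite upd_same T0 hf.
- by move=> m lt; apply: hp.
- by move=> m lt; apply: hf.
Qed.

Definition move_act (m : move) (a : sym) : sym * move := (a, m).
Definition write_act (b : sym) (m : move) (_ : sym) : sym * move := (b, m).

Lemma rep_upd_ctr (D : {set index}) s (T : tapes) c n t : ord0 != ord_max :> index -> c \in D ->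
  rep D s T -> ctr n t -> rep D (upd s.1.1 c n, s.1.2, s.2) (upd T c t).
Proof.
move=> ne cD [n0 nm hi ho hc] ct.
have c0 : ord0 != c by apply: contraNneq n0 => ->.
have cm : ord_max != c by apply: contraNneq nm => ->.
split; rewrite ?upd_neq // => d dD; rewrite !ffunE.
by case: eqP => // _; apply: hc.
Qed.

Lemma frame_upd (D : {set index}) (T : tapes) c t : c \in D -> frame D T (upd T c t).
Proof. by move=> cD d nd _ _; rewrite upd_neq //; apply: contraNneq nd => ->. Qed.

Definition Inc (c : index) : stm := Act c (write_act mark MRight).

Lemma hoare_inc (D : {set index}) c (s : state) : c \in D ->
  hoare D (Inc c) s (upd s.1.1 c (s.1.1 c).+1, s.1.2, s.2) 1.
Proof.
move=> cD ne T r; exists (upd T c (act_tape (write_act mark MRight) (T c))).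
split; [exact: tri_act| |exact: frame_upd].
apply: rep_upd_ctr => //; case: r => _ _ _ _ /(_ c cD)[u [v ->]].
by exists u, v.-1; rewrite /act_tape /=; case: v.
Qed.

Definition Zero (c : index) : stm :=
  Sq (Act c (move_act MLeft)) (Wh c nonblank (Act c (write_act None MLeft))).

Lemma hoare_zero (D : {set index}) c (s : state) : c \in D ->
  hoare D (Zero c) s (upd s.1.1 c 0, s.1.2, s.2) (2 * s.1.1 c + 2).
Proof.
move=> cD ne T r; have [_ _ _ _ /(_ c cD)[u [v Tc]]] := r.
move: (s.1.1 c) Tc => n Tc.
pose L r := nseq r mark ++ nseq u (None : sym).
pose t m : tape void := (behead (L (n - m)), head None (L (n - m)),
   nseq (m.+1 + v) None).
exists (upd T c (t n)); split; last exact: frame_upd.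
  have -> : 2 * n + 2 = 1 + (2 * n + 1) by lia.
  apply: tri_seq (tri_act _ _ _) _.
  have -> : upd T c (t n) = upd (upd T c (act_tape (move_act MLeft) (T c))) c (t n).
    by apply/ffunP => j; rewrite !ffunE; case: eqP.
  apply: tri_wh_act.
  - by rewrite upd_same Tc /t subn0.
  - by move=> m lt; rewrite /t /L; case E : (n - m) => //; lia.
  - by rewrite /t /L subnn; case: (u).
  - move=> m lt; rewrite /t /L; have -> : n - m = (n - m.+1).+1 by lia.
    by [].
apply: rep_upd_ctr => //; exists u.-1, (n.+1 + v).
by rewrite /t /L subnn; case: (u).
Qed.

Definition Out (b : bool) : stm := Act ord_max (write_act (Some (inl b)) MRight).

Lemma hoare_out (D : {set index}) b (s : state) : hoare D (Out b) s (s.1, rcons s.2 b) 1.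
Proof.
move=> ne T [n0 nm hi ho hc].
exists (upd T ord_max (act_tape (write_act (Some (inl b)) MRight) (T ord_max))).
split; first exact: tri_act.
  split=> //; first by rewrite upd_neq.
    by rewrite upd_same ho /otape map_rcons rev_rcons.
  move=> c cD; rewrite upd_neq; first exact: hc.
  by apply: contraNneq nm => <-.
by move=> c _ _ cm; rewrite upd_neq.
Qed.

Definition Nop : stm := Act ord0 (move_act MStay).

Lemma hoare_nop (D : {set index}) s : hoare D Nop s s 1.
Proof.
move=> ne T r; exists T; split=> //.
have {2}-> : T = upd T ord0 (act_tape (move_act MStay) (T ord0)).
  by apply/ffunP => j; rewrite ffunE; case: eqP => // ->; case: (T ord0) => -[].
exact: tri_act.
Qed.

Definition InR : stm := Act ord0 (move_act MRight).
Definition InL : stm := Act ord0 (move_act MLeft).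

Lemma rep_upd_inp (D : {set index}) s (T : tapes) pos t : ord0 != ord_max :> index ->
  rep D s T -> inp pos t -> rep D (s.1.1, pos, s.2) (upd T ord0 t).
Proof.
move=> ne [n0 nm hi ho hc] it; split=> //; rewrite ?upd_same //.
  by rewrite upd_neq // eq_sym.
move=> c cD; rewrite upd_neq; first exact: hc.
by apply: contraNneq n0 => <-.
Qed.

Lemma hoare_inR (D : {set index}) (s : state) : hoare D InR s (s.1.1, s.1.2.+1, s.2) 1.
Proof.
move=> ne T r; exists (upd T ord0 (act_tape (move_act MRight) (T ord0))).
split; [exact: tri_act| |by move=> c _ c0 _; rewrite upd_neq].
apply: rep_upd_inp => //; case: r => _ _ [l [ls hl] ->] _ _.
(* Stepping past the explored part of the input uncovers one more blank. *)
exists (if s.1.2.+1 < size l then l else rcons l None).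
  split; first by case: ifP => //; rewrite size_rcons; lia.
  move=> j; rewrite -hl; case: ifP => // _.
  rewrite nth_rcons; case: ltngtP => // [lt|->]; first by rewrite nth_default // ltnW.
  by rewrite nth_default.
rewrite /act_tape /=; case: ifP => lt.
  rewrite (take_nth None) // rev_rcons (drop_nth None lt) /=.
  by [].
have e : s.1.2.+1 = size l by lia.
rewrite e drop_size /= -cats1 take_size_cat // nth_cat ltnn subnn /=.
rewrite drop_oversize ?size_cat ?addn1 //.
congr (_, _, _); rewrite -{4}(take_size l) -e (take_nth None) // rev_rcons.
by [].
Qed.

Lemma hoare_inL (D : {set index}) (s : state) n : s.1.2 = n.+1 -> hoare D InL s (s.1.1, n, s.2) 1.
Proof.
move=> sn ne T r; exists (upd T ord0 (act_tape (move_act MLeft) (T ord0))).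
split; [exact: tri_act| |by move=> c _ c0 _; rewrite upd_neq].
apply: rep_upd_inp => //; case: r => _ _ [l [ls hl] ->] _ _.
rewrite sn in ls *; exists l; first by split=> //; apply: ltnW.
rewrite /act_tape /= (take_nth None) ?rev_rcons /=; last exact: ltnW.
by rewrite (drop_nth None ls).
Qed.

(** The head of tape [c] walks left over the marks, runs the body once per mark, and returns at the
    end. The counter is thus its own loop variable and is not consumed, but the body cannot use
    it. *)
Definition Rep (c : index) (P : stm) : stm :=
  Sq (Act c (move_act MLeft))
  (Sq (Wh c nonblank (Sq P (Act c (move_act MLeft))))
  (Sq (Act c (move_act MRight)) (Wh c nonblank (Act c (move_act MRight))))).

Lemma rep_setD1 (D : {set index}) c s (T : tapes) : rep D s T -> rep (D :\ c) s T.
Proof.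
move=> [n0 nm hi ho hc]; split=> //; rewrite ?inE ?negb_and ?n0 ?nm ?orbT //.
by move=> d /setD1P[_ /hc].
Qed.

Lemma rep_setD1_upd (D : {set index}) c s (T : tapes) t : c \in D -> ord0 \notin D -> ord_max \notin D ->
  rep (D :\ c) s T -> rep (D :\ c) s (upd T c t).
Proof.
move=> cD n0 nm [n0' nm' hi ho hc]; split=> //.
- by rewrite upd_neq //; apply: contraNneq n0 => ->.
- by rewrite upd_neq //; apply: contraNneq nm => ->.
- by move=> d dD; rewrite upd_neq; [apply: hc|move: dD => /setD1P[]].
Qed.

Lemma hoare_rep (D : {set index}) c P (S : nat -> state) n t : c \in D ->
  (forall m, m < n -> hoare (D :\ c) P (S m) (S m.+1) t) ->
  (S 0).1.1 c = n -> (S n).1.1 c = n ->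
  hoare D (Rep c P) (S 0) (S n) (n * (t + 4) + 4).
Proof.
move=> cD hP S0 Sn ne T r; have [n0 nm _ _ /(_ c cD)[u [v]]] := r.
rewrite S0 => Tc.
have c0 : c != ord0 by apply: contraNneq n0 => <-.
have cm : c != ord_max by apply: contraNneq nm => <-.
pose L r := nseq r mark ++ nseq u (None : sym).
(* The head is on the [r]-th mark from the left, so [r] rounds remain; [mid 0] scans the blank
   before the marks. *)
pose mid r : tape void := (behead (L r), head None (L r),
  nseq (n - r) mark ++ None :: nseq v None).
have loop m : m <= n -> forall T : tapes, rep (D :\ c) (S (n - m)) T -> T c = mid m ->
    exists T' : tapes, [/\ tri (Wh c nonblank (Sq P (Act c (move_act MLeft)))) T T'
        (m * (t + 2) + 1), rep (D :\ c) (S n) T', T' c = mid 0 & frame D T T'].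
  elim: m => [|m IH] le {r Tc} {}T r Tc.
    exists T; rewrite subn0 in r; split=> //.
    by apply: tri_wh0; rewrite Tc /mid /L; case: (u).
  have [|T1 [h1 r1 f1]] := hP (n - m.+1) _ ne _ r; first by lia.
  have T1c : T1 c = mid m.+1 by rewrite f1 // !inE eqxx.
  have [|||T2 [h2 r2 Tc2 f2]] := IH _ (upd T1 c (act_tape (move_act MLeft) (T1 c))).
  - exact: ltnW.
  - by apply: rep_setD1_upd => //; have -> : n - m = (n - m.+1).+1 by lia.
  - rewrite upd_same T1c /mid /act_tape /=; have -> : n - m = (n - m.+1).+1 by lia.
    by [].
  exists T2; split=> //.
    have -> : m.+1 * (t + 2) + 1 = ((t + 1) + (m * (t + 2) + 1)).+1 by lia.
    apply: tri_whS h2; first by rewrite Tc.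
    exact: tri_seq h1 (tri_act _ _ _).
  move=> d dD d0 dm; rewrite f2 // upd_neq; last by apply: contraNneq dD => ->.
  by rewrite f1 // !inE negb_and dD orbT.
have [||T1 [h1 r1 T1c f1]] := loop n (leqnn n)
  (upd T c (act_tape (move_act MLeft) (T c))).
- by apply: rep_setD1_upd => //; rewrite subnn; apply: rep_setD1.
- by rewrite upd_same Tc /mid subnn.
pose R m := nseq (n - m) mark ++ (None : sym) :: nseq v None.
pose bk m : tape void := (nseq m mark ++ nseq u.-1.+1 None, head None (R m), behead (R m)).
exists (upd T1 c (bk n)); split.
- have -> : n * (t + 4) + 4 = 1 + ((n * (t + 2) + 1) + (1 + (2 * n + 1))) by lia.
  apply: tri_seq (tri_act _ _ _) _; apply: tri_seq h1 _.
  apply: tri_seq (tri_act _ _ _) _.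
  have -> : upd T1 c (bk n) = upd (upd T1 c (act_tape (move_act MRight) (T1 c))) c (bk n).
    by apply/ffunP => j; rewrite !ffunE; case: eqP.
  apply: tri_wh_act.
  + rewrite upd_same T1c /mid /bk /R /act_tape /L subn0 /=.
    by case: (u) => [|u'] /=.
  + by move=> m lt; rewrite /bk /R; case E : (n - m) => //; lia.
  + by rewrite /bk /R subnn.
  + move=> m lt; rewrite /bk /R; have -> : n - m = (n - m.+1).+1 by lia.
    by [].
- case: r1 => n0' nm' hi ho hc; split=> //; rewrite ?upd_neq 1?eq_sym // => d dD.
  rewrite ffunE; case: eqP => [->|/eqP dc]; last by apply: hc; rewrite !inE dc.
  by rewrite Sn; exists u.-1.+1, v; rewrite /bk /R subnn.
- move=> d dD d0 dm; have dc : d != c by apply: contraNneq dD => ->.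
  by rewrite upd_neq // f1 // upd_neq.
Qed.

Lemma hoare_br_in (D : {set index}) (p : pred sym) P Q (s s' : state) n :
  hoare D (if p (omap inl (input_at w s.1.2)) then P else Q) s s' n ->
  hoare D (Br ord0 p P Q) s s' n.+1.
Proof.
move=> h ne T r; have [T' [h1 r1 f1]] := h ne T r; exists T'; split=> //.
apply: tri_br; case: r => _ _ [l [_ hl] ->] _ _.
by rewrite /tape_read /= hl.
Qed.

End Counters.

(** * A loop language for writing strings *)

Section Emit.
Variable k : nat.
Local Notation index := 'I_k.+1.
Local Notation stm := (stm k).
Local Notation env := (env k).

Inductive emit :=
| EStr of seq bool
| ECat of emit & emit
| ERep of index & emit
| EFor of index & index & emit
| ECase of index & (option bool -> emit).

(* [EFor x y P] runs [P] with the counter [x] at [0 .. y - 1]; [ECase x P] runs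
   [P] on the [x]-th letter of the input. *)
Fixpoint den (w : seq bool) (P : emit) (e : env) : seq bool :=
  match P with
  | EStr s => s
  | ECat P Q => den w P e ++ den w Q e
  | ERep c P => flatten (nseq (e c) (den w P e))
  | EFor x y P => flatten [seq den w P (upd e x i) | i <- iota 0 (e y)]
  | ECase x P => den w (P (input_at w (e x))) e
  end.

(* [D] contains the usable counters, [Z] those that are zero. *)
Fixpoint wf (D Z : {set index}) (P : emit) : bool :=
  match P with
  | EStr _ => true
  | ECat P Q => wf D Z P && wf D Z Q
  | ERep c P => (c \in D) && wf (D :\ c) Z P
  | EFor x y P => [&& x \in D, x \in Z, y \in D, x != y & wf (D :\ y) (Z :\ x) P]
  | ECase x P => [&& x \in D, wf D Z (P None), wf D Z (P (Some true))
                   & wf D Z (P (Some false))]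
  end.

Definition is_true_sym (s : symbol void) : bool :=
  if s is Some (inl b) then b else false.

(** In [ECase] the letter read is remembered by the control state alone, so the return of the input
    head is repeated in each branch. [EFor] clears its index at the end, ready for the next use. *)
Fixpoint compile (P : emit) : stm :=
  match P with
  | EStr s => foldr (fun b Q => Sq (Out k b) Q) (Nop k) s
  | ECat P Q => Sq (compile P) (compile Q)
  | ERep c P => Rep c (compile P)
  | EFor x y P => Sq (Rep y (Sq (compile P) (Inc x))) (Zero x)
  | ECase x P => Sq (Rep x (InR k)) (Br ord0 nonblank
      (Br ord0 is_true_sym (Sq (Rep x (InL k)) (compile (P (Some true))))
                           (Sq (Rep x (InL k)) (compile (P (Some false)))))
      (Sq (Rep x (InL k)) (compile (P None))))
  end.

(** With [B] bounding the counters, this bounds the running time and, by [size_den], the output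
    length. *)
Fixpoint cost (B : nat) (P : emit) : nat :=
  match P with
  | EStr s => size s + 1
  | ECat P Q => cost B P + cost B Q
  | ERep c P => B * (cost B P + 4) + 4
  | EFor x y P => (B * (cost B P + 1 + 4) + 4) + (2 * B + 2)
  | ECase x P => (B * 5 + 4) + ((B * 5 + 4) +
      (cost B (P None) + cost B (P (Some true)) + cost B (P (Some false)))).+2
  end.

Lemma upd_upd (I : finType) (U : Type) (f : {ffun I -> U}) i a b :
  upd (upd f i a) i b = upd f i b.
Proof. by apply/ffunP => j; rewrite !ffunE; case: eqP. Qed.

Lemma upd_id (I : finType) (U : Type) (f : {ffun I -> U}) i a : f i = a -> upd f i a = f.
Proof. by move=> fi; apply/ffunP => j; rewrite !ffunE; case: eqP => // ->. Qed.

Lemma hoare_str w (D : {set index}) s (e : env) pos out :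
  hoare w D (compile (EStr s)) (e, pos, out) (e, pos, out ++ s) (size s + 1).
Proof.
elim: s out => [|b s IH] out /=; first by rewrite cats0; apply: hoare_nop.
by rewrite -cat_rcons -addn1 -addnA addnCA; apply: hoare_seq (IH _); apply: hoare_out.
Qed.

Lemma hoare_rep_inR w (D : {set index}) x (e : env) out : x \in D ->
  hoare w D (Rep x (InR k)) (e, 0, out) (e, e x, out) (e x * 5 + 4).
Proof.
move=> xD; apply: (hoare_rep (S := fun m => (e, m, out)) (t := 1)) => // m _.
exact: hoare_inR.
Qed.

Lemma hoare_rep_inL w (D : {set index}) x (e : env) out : x \in D ->
  hoare w D (Rep x (InL k)) (e, e x, out) (e, 0, out) (e x * 5 + 4).
Proof.
move=> xD; have := @hoare_rep k w D x (InL k) (fun m => (e, e x - m, out)) (e x) 1 xD.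
rewrite /= subnn subn0; apply=> // m lt.
have -> : e x - m = (e x - m.+1).+1 by lia.
exact: hoare_inL.
Qed.

(** Counters and input position are restored, so fragments compose and iterate with only the output
    changing. *)
Lemma hoare_emit w B P (D Z : {set index}) (e : env) out : wf D Z P ->
  (forall c, c \in D -> e c <= B) -> (forall z, z \in Z -> e z = 0) ->
  hoare w D (compile P) (e, 0, out) (e, 0, out ++ den w P e) (cost B P).
Proof.
elim: P D Z e out => [s|P IHP Q IHQ|c P IH|x y P IH|x P IH] D Z e out.
- by move=> _ _ _; apply: hoare_str.
- move=> /= /andP[wP wQ] eB eZ; rewrite catA.
  exact: hoare_seq (IHP _ _ _ _ wP eB eZ) (IHQ _ _ _ _ wQ eB eZ).
- move=> /= /andP[cD wP] eB eZ.
  pose S m : state k := (e, 0, out ++ flatten (nseq m (den w P e))).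
  have S0 : S 0 = (e, 0, out) by rewrite /S cats0.
  rewrite -S0 -[X in hoare _ _ _ _ X _]/(S (e c)).
  apply: hoare_le (hoare_rep (t := cost B P) cD _ _ _) _ => //.
    move=> m _; have -> : S m.+1 = (e, 0, (out ++ flatten (nseq m (den w P e))) ++ den w P e).
      by rewrite /S -addn1 nseqD flatten_cat /= cats0 catA.
    by apply: IH wP _ eZ => d /setD1P[_ /eB].
  by rewrite leq_add2r leq_mul2r eB ?orbT.
- move=> /= /and5P[xD xZ yD xy wP] eB eZ.
  pose S m : state k :=
    (upd e x m, 0, out ++ flatten [seq den w P (upd e x i) | i <- iota 0 m]).
  have e0 : upd e x 0 = e by apply: upd_id; apply: eZ.
  have S0 : S 0 = (e, 0, out) by rewrite /S /= cats0 e0.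
  have yx : y != x by rewrite eq_sym.
  apply: (@hoare_seq _ _ _ _ _ _ (S (e y))); last first.
    have := @hoare_zero k w D x (S (e y)) xD.
    rewrite /S /= upd_same upd_upd e0 => h; apply: hoare_le h _.
    by rewrite leq_add2r leq_mul2l eB.
  rewrite -S0; apply: hoare_le (hoare_rep (t := cost B P + 1) yD _ _ _) _.
  + move=> m lt; apply: (@hoare_seq _ _ _ _ _ _
      (upd e x m, 0, (S m).2 ++ den w P (upd e x m))).
      apply: IH wP _ _ => d.
        move=> /setD1P[_ dD]; rewrite ffunE; case: eqP => _; last exact: eB.
        by apply: leq_trans (eB _ yD); apply: ltnW.
      by move=> /setD1P[dx dZ]; rewrite upd_neq // eZ.
    have -> : S m.+1 = (upd (upd e x m) x (upd e x m x).+1, 0,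
                        (S m).2 ++ den w P (upd e x m)).
      rewrite /S upd_upd upd_same -[m.+1]addn1 iotaD map_cat flatten_cat /=.
      by rewrite cats0 catA addn1.
    by apply: hoare_inc; rewrite !inE xy.
  + by rewrite upd_neq.
  + by rewrite upd_neq.
  + by rewrite leq_add2r leq_mul2r eB ?orbT.
- move=> /= /and4P[xD wN wT wF] eB eZ.
  have le5 : e x * 5 + 4 <= B * 5 + 4 by rewrite leq_add2r leq_mul2r eB.
  apply: hoare_seq; first exact (hoare_le (@hoare_rep_inR w D x e out xD) le5).
  have sq o : wf D Z (P o) ->
      hoare w D (Sq (Rep x (InL k)) (compile (P o))) (e, e x, out)
        (e, 0, out ++ den w (P o) e) (B * 5 + 4 + cost B (P o)).
    move=> wo; apply: hoare_seq.
      exact (hoare_le (@hoare_rep_inL w D x e out xD) le5).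
    exact: IH eZ.
  apply: hoare_br_in; case E : (input_at w (e x)) => [b|]; rewrite /= ?E /=.
    apply: hoare_br_in; rewrite /= E /=.
    by case: b {E}; [apply: (hoare_le (sq _ wT))|apply: (hoare_le (sq _ wF))];
      rewrite leq_add2l; lia.
  by apply: (hoare_le (sq _ wN)); lia.
Qed.

End Emit.

(** * Polynomial bounds *)

(** The base [n.+1] is positive, so raising the exponent never lowers the bound; this gives closure
    under sums. *)
Definition polyb (f : nat -> nat) : Prop :=
  exists a b, forall n, f n <= a * n.+1 ^ b.

Lemma polyb_le f g : polyb g -> (forall n, f n <= g n) -> polyb f.
Proof. by move=> [a [b h]] le; exists a, b => n; apply: leq_trans (le n) (h n). Qed.

Lemma polyb_const c : polyb (fun=> c).
Proof. by exists c, 0 => n; rewrite expn0 muln1. Qed.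

Lemma polyb_id : polyb id.
Proof. by exists 1, 1 => n; rewrite mul1n expn1. Qed.

Lemma polyb_add f g : polyb f -> polyb g -> polyb (fun n => f n + g n).
Proof.
move=> [a [b h]] [a' [b' h']]; exists (a + a'), (b + b') => n.
rewrite mulnDl; apply: leq_add.
  by apply: leq_trans (h n) _; rewrite leq_mul2l leq_pexp2l ?leq_addr ?orbT.
by apply: leq_trans (h' n) _; rewrite leq_mul2l leq_pexp2l ?leq_addl ?orbT.
Qed.

Lemma polyb_mul f g : polyb f -> polyb g -> polyb (fun n => f n * g n).
Proof.
move=> [a [b h]] [a' [b' h']]; exists (a * a'), (b + b') => n.
by rewrite expnD mulnACA; apply: leq_mul.
Qed.

Lemma polyb_S f : polyb f -> polyb (fun n => (f n).+1).
Proof.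
move=> h; apply: polyb_le (polyb_add h (polyb_const 1)) _ => n.
by rewrite addn1.
Qed.

Lemma polyb_poly f : polyb f -> exists p : {poly nat}, forall n, f n <= p.[n]%R.
Proof.
move=> [a [b h]]; exists (a%:P * ('X + 1%:P) ^+ b)%R => n.
rewrite hornerM horner_exp hornerD hornerX !hornerC.
by have := h n; rewrite -addn1.
Qed.

(** Horner's scheme on the coefficient list, in the order in which the machine evaluates the
    polynomial. *)
Fixpoint hval (s : seq nat) (n : nat) : nat :=
  if s is a :: s' then hval s' n * n + a else 0.

Lemma hval_horner (p : {poly nat}) n : p.[n]%R = hval p n.
Proof. by rewrite /horner; elim: (polyseq p) => //= a s ->. Qed.

Lemma polyb_hval s : polyb (hval s).
Proof.
elim: s => [|a s IH] /=; first exact: polyb_const.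
exact: polyb_add (polyb_mul IH polyb_id) (polyb_const a).
Qed.

Ltac polyb := repeat first [assumption | exact: polyb_id | exact: polyb_const
  | exact: polyb_hval | apply: polyb_add | apply: polyb_mul | apply: polyb_S].

Lemma polyb_cost k (P : emit k) (f : nat -> nat) :
  polyb f -> polyb (fun n => cost (f n) P).
Proof.
move=> hf; elim: P => [s|P IHP Q IHQ|c P IH|x y P IH|x P IH] /=; polyb; exact: IH.
Qed.

Lemma size_den k w (P : emit k) (D Z : {set 'I_k.+1}) (e : env k) B : wf D Z P ->
  (forall c, c \in D -> e c <= B) -> size (den w P e) <= cost B P.
Proof.
elim: P D Z e => [s|P IHP Q IHQ|c P IH|x y P IH|x P IH] D Z e /=.
- by move=> _ _; apply: leq_addr.
- move=> /andP[wP wQ] eB; rewrite size_cat.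
  exact: leq_add (IHP _ _ _ wP eB) (IHQ _ _ _ wQ eB).
- move=> /andP[cD wP] eB; rewrite size_flatten /shape map_nseq sumn_nseq mulnC.
  apply: leq_trans (leq_addr _ _); apply: leq_mul; first exact: eB.
  apply: leq_trans (leq_addr _ _); apply: IH wP _ => d /setD1P[_ /eB//].
- move=> /and5P[xD _ yD xy wP] eB; rewrite size_flatten /shape -map_comp.
  apply: leq_trans (_ : B * cost B P <= _); last by lia.
  apply: leq_trans (_ : e y * cost B P <= _); last by rewrite leq_mul2r eB ?orbT.
  suff H l : all (fun i => i < e y) l ->
      sumn [seq size (den w P (upd e x i)) | i <- l] <= size l * cost B P.
    rewrite -[X in _ <= X * _](size_iota 0 (e y)); apply: H.
    by apply/allP => i; rewrite mem_iota add0n => /andP[].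
  elim: l => //= i l IHl /andP[lt al].
  rewrite mulSn; apply: leq_add (IHl al); apply: IH wP _ => d /setD1P[_ dD].
  rewrite ffunE; case: eqP => _; last exact: eB.
  by apply: leq_trans (eB _ yD); apply: ltnW.
- move=> /and4P[xD wN wT wF] eB.
  have h o : wf D Z (P o) -> size (den w (P o) e) <= cost B (P o).
    by move=> wo; apply: IH wo eB.
  by case: (input_at _ _) => [[]|]; [have := h _ wT|have := h _ wF|have := h _ wN]; lia.
Qed.

(** * The machine *)

Section Writer.
Variable w : seq bool.

Local Notation hoare := (hoare w).
Definition c_n : 'I_10 := @Ordinal 10 1 isT.
Definition c_K : 'I_10 := @Ordinal 10 2 isT.
Definition c_0 : 'I_10 := @Ordinal 10 3 isT.
Definition c_X : 'I_10 := @Ordinal 10 4 isT.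
Definition c_N : 'I_10 := @Ordinal 10 5 isT.
Definition c_N' : 'I_10 := @Ordinal 10 6 isT.
Definition c_i : 'I_10 := @Ordinal 10 7 isT.
Definition c_j : 'I_10 := @Ordinal 10 8 isT.

Definition ctrs : {set 'I_10} := [set c : 'I_10 | 0 < c < 9].

(** The leading 0 fills the place of the input tape; [c_i] and [c_j] lie beyond the list and are
    therefore zero. *)
Definition mkenv (n K z X N N' : nat) : env 9 :=
  [ffun c : 'I_10 => nth 0 [:: 0; n; K; z; X; N; N'] c].

Lemma mkenvE n K z X N N' (c : 'I_10) :
  mkenv n K z X N N' c = nth 0 [:: 0; n; K; z; X; N; N'] c.
Proof. by rewrite ffunE. Qed.

Lemma upd_n n K z X N N' m : upd (mkenv n K z X N N') c_n m = mkenv m K z X N N'.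
Proof. by apply/ffunP => -[[|[|[|[|[|[|[|?]]]]]]] ?]; rewrite !ffunE. Qed.
Lemma upd_K n K z X N N' m : upd (mkenv n K z X N N') c_K m = mkenv n m z X N N'.
Proof. by apply/ffunP => -[[|[|[|[|[|[|[|?]]]]]]] ?]; rewrite !ffunE. Qed.
Lemma upd_0 n K z X N N' m : upd (mkenv n K z X N N') c_0 m = mkenv n K m X N N'.
Proof. by apply/ffunP => -[[|[|[|[|[|[|[|?]]]]]]] ?]; rewrite !ffunE. Qed.
Lemma upd_X n K z X N N' m : upd (mkenv n K z X N N') c_X m = mkenv n K z m N N'.
Proof. by apply/ffunP => -[[|[|[|[|[|[|[|?]]]]]]] ?]; rewrite !ffunE. Qed.
Lemma upd_N n K z X N N' m : upd (mkenv n K z X N N') c_N m = mkenv n K z X m N'.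
Proof. by apply/ffunP => -[[|[|[|[|[|[|[|?]]]]]]] ?]; rewrite !ffunE. Qed.
Lemma upd_N' n K z X N N' m : upd (mkenv n K z X N N') c_N' m = mkenv n K z X N m.
Proof. by apply/ffunP => -[[|[|[|[|[|[|[|?]]]]]]] ?]; rewrite !ffunE. Qed.

Definition updE := (upd_n, upd_K, upd_0, upd_X, upd_N, upd_N', mkenvE).

Definition Count : stm 9 := Sq (Wh ord0 nonblank (Sq (Inc c_n) (InR 9))) (Rep c_n (InL 9)).

(** The product is gathered in [c_0] and copied back. Since [c_0] ends at zero, it later serves as
    the constant index 0. *)
Definition Mul : stm 9 := Sq (Rep c_K (Rep c_n (Inc c_0)))
  (Sq (Zero c_K) (Sq (Rep c_0 (Inc c_K)) (Zero c_0))).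

Definition Incs (c : 'I_10) (a : nat) : stm 9 := iter a (Sq (Inc c)) (Nop 9).

Fixpoint Horner (s : seq nat) : stm 9 :=
  if s is a :: s' then Sq (Horner s') (Sq Mul (Incs c_K a)) else Nop 9.

(** The number of cells is kept twice: [c_N] drives the loops over cells, in whose bodies [c_N'] is
    still free for computing indices. *)
Definition Fan : stm 9 := Sq (Rep c_K (Sq (Inc c_X) (Sq (Inc c_N) (Inc c_N'))))
  (Sq (Incs c_N 3) (Incs c_N' 3)).

Lemma hoare_wh0 D (p : pred (symbol void)) P (s : state 9) :
  p (omap inl (input_at w s.1.2)) = false -> hoare D (Wh ord0 p P) s s 1.
Proof.
move=> hp ne T r; exists T; split=> //; apply: tri_wh0.
by case: r => _ _ [l [_ hl] ->] _ _; rewrite /tape_read /= hl.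
Qed.

Lemma hoare_whS D (p : pred (symbol void)) P (s s1 s2 : state 9) n1 n2 :
  p (omap inl (input_at w s.1.2)) -> hoare D P s s1 n1 ->
  hoare D (Wh ord0 p P) s1 s2 n2 -> hoare D (Wh ord0 p P) s s2 (n1 + n2).+1.
Proof.
move=> hp h1 h2 ne T r; have [T1 [t1 r1 f1]] := h1 ne T r.
have [T2 [t2 r2 f2]] := h2 ne T1 r1; exists T2; split=> //.
  apply: tri_whS t1 t2.
  by case: r => _ _ [l [_ hl] ->] _ _; rewrite /tape_read /= hl.
by move=> c *; rewrite f2 // f1.
Qed.

Lemma hoare_count : hoare ctrs Count (mkenv 0 0 0 0 0 0, 0, [::])
  (mkenv (size w) 0 0 0 0 0, 0, [::]) ((3 * size w + 1) + (size w * 5 + 4)).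
Proof.
apply: (@hoare_seq _ _ _ _ _ _ (mkenv (size w) 0 0 0 0 0, size w, [::])); last first.
  have := @hoare_rep_inL 9 w ctrs c_n (mkenv (size w) 0 0 0 0 0) [::].
  by rewrite !updE; apply; rewrite inE.
suff H m : m <= size w -> hoare ctrs (Wh ord0 nonblank (Sq (Inc c_n) (InR 9)))
    (mkenv (size w - m) 0 0 0 0 0, size w - m, [::])
    (mkenv (size w) 0 0 0 0 0, size w, [::]) (3 * m + 1).
  by have := H _ (leqnn _); rewrite subnn.
elim: m => [|m IH] le.
  by rewrite subn0; apply: hoare_wh0; rewrite /input_at nth_default // size_map.
have -> : 3 * m.+1 + 1 = (2 + (3 * m + 1)).+1 by lia.
apply: hoare_whS (IH (ltnW le)).
  by rewrite /input_at (nth_map true) //=; lia.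
have -> : size w - m = (size w - m.+1).+1 by lia.
apply: (@hoare_seq _ _ _ _ _ _
  (mkenv (size w - m.+1).+1 0 0 0 0 0, size w - m.+1, [::]) _ 1 1).
  have := @hoare_inc 9 w ctrs c_n (mkenv (size w - m.+1) 0 0 0 0 0, size w - m.+1, [::]).
  by rewrite /= !updE; apply; rewrite inE.
exact: hoare_inR.
Qed.

Lemma hoare_mul n a : hoare ctrs Mul (mkenv n a 0 0 0 0, 0, [::])
  (mkenv n (a * n) 0 0 0 0, 0, [::])
  ((a * (n * 5 + 4 + 4) + 4) + ((2 * a + 2) + ((a * n * 5 + 4) + (2 * (a * n) + 2)))).
Proof.
apply: (@hoare_seq _ _ _ _ _ _ (mkenv n a (a * n) 0 0 0, 0, [::])).
  apply: (@hoare_rep 9 w ctrs c_K _ (fun m => (mkenv n a (m * n) 0 0 0, 0, [::])) a);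
    rewrite ?inE ?updE // => m _.
  have := @hoare_rep 9 w (ctrs :\ c_K) c_n (Inc c_0)
    (fun m' => (mkenv n a (m * n + m') 0 0 0, 0, [::])) n 1.
  rewrite addn0 mulSnr !updE; apply=> //; first by rewrite !inE.
  move=> m' _; have := @hoare_inc 9 w (ctrs :\ c_K :\ c_n) c_0
    (mkenv n a (m * n + m') 0 0 0, 0, [::]).
  by rewrite /= !updE addnS; apply; rewrite !inE.
apply: (@hoare_seq _ _ _ _ _ _ (mkenv n 0 (a * n) 0 0 0, 0, [::])).
  have := @hoare_zero 9 w ctrs c_K (mkenv n a (a * n) 0 0 0, 0, [::]).
  by rewrite /= !updE; apply; rewrite !inE.
apply: (@hoare_seq _ _ _ _ _ _ (mkenv n (a * n) (a * n) 0 0 0, 0, [::])).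
  apply: (@hoare_rep 9 w ctrs c_0 _ (fun m => (mkenv n m (a * n) 0 0 0, 0, [::]))
    (a * n) 1); rewrite ?inE ?updE // => m _.
  have := @hoare_inc 9 w (ctrs :\ c_0) c_K (mkenv n m (a * n) 0 0 0, 0, [::]).
  by rewrite /= !updE; apply; rewrite !inE.
have := @hoare_zero 9 w ctrs c_0 (mkenv n (a * n) (a * n) 0 0 0, 0, [::]).
by rewrite /= !updE; apply; rewrite !inE.
Qed.

Lemma hoare_incs (D : {set 'I_10}) c a (e : env 9) out : c \in D ->
  hoare D (Incs c a) (e, 0, out) (upd e c (e c + a), 0, out) (a + 1).
Proof.
move=> cD; elim: a e => [|a IH] e /=.
  by rewrite addn0 upd_id //; apply: hoare_nop.
rewrite [a.+1 + 1]addSn -[(a + 1).+1]add1n.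
apply: (@hoare_seq _ _ _ _ _ _ (upd e c (e c).+1, 0, out)).
  exact: (@hoare_inc 9 w D c (e, 0, out)).
by have := IH (upd e c (e c).+1); rewrite upd_same upd_upd addSnnS.
Qed.

Fixpoint horner_cost (s : seq nat) (n : nat) : nat :=
  if s is a :: s' then let v := hval s' n in
    horner_cost s' n + (((v * (n * 5 + 4 + 4) + 4) +
     ((2 * v + 2) + ((v * n * 5 + 4) + (2 * (v * n) + 2)))) + (a + 1))
  else 1.

Lemma hoare_horner s n : hoare ctrs (Horner s) (mkenv n 0 0 0 0 0, 0, [::])
  (mkenv n (hval s n) 0 0 0 0, 0, [::]) (horner_cost s n).
Proof.
elim: s => [|a s IH]; first exact: hoare_nop.
apply: (hoare_seq IH (hoare_seq (@hoare_mul n (hval s n)) _)).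
have := @hoare_incs ctrs c_K a (mkenv n (hval s n * n) 0 0 0 0) [::].
by rewrite !updE; apply; rewrite inE.
Qed.

Lemma hoare_fan n X : hoare ctrs Fan (mkenv n X 0 0 0 0, 0, [::])
  (mkenv n X 0 X (X + 3) (X + 3), 0, [::]) ((X * (3 + 4) + 4) + ((3 + 1) + (3 + 1))).
Proof.
apply: (@hoare_seq _ _ _ _ _ _ (mkenv n X 0 X X X, 0, [::])).
  apply: (@hoare_rep 9 w ctrs c_K _ (fun m => (mkenv n X 0 m m m, 0, [::])) X 3);
    rewrite ?inE ?updE // => m _.
  apply: (@hoare_seq _ _ _ _ _ _ (mkenv n X 0 m.+1 m m, 0, [::]) _ 1 2).
    have := @hoare_inc 9 w (ctrs :\ c_K) c_X (mkenv n X 0 m m m, 0, [::]).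
    by rewrite /= !updE; apply; rewrite !inE.
  apply: (@hoare_seq _ _ _ _ _ _ (mkenv n X 0 m.+1 m.+1 m, 0, [::]) _ 1 1).
    have := @hoare_inc 9 w (ctrs :\ c_K) c_N (mkenv n X 0 m.+1 m m, 0, [::]).
    by rewrite /= !updE; apply; rewrite !inE.
  have := @hoare_inc 9 w (ctrs :\ c_K) c_N' (mkenv n X 0 m.+1 m.+1 m, 0, [::]).
  by rewrite /= !updE; apply; rewrite !inE.
apply: (@hoare_seq _ _ _ _ _ _ (mkenv n X 0 X (X + 3) X, 0, [::])).
  have := @hoare_incs ctrs c_N 3 (mkenv n X 0 X X X) [::].
  by rewrite !updE; apply; rewrite inE.
have := @hoare_incs ctrs c_N' 3 (mkenv n X 0 X (X + 3) X) [::].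
by rewrite !updE; apply; rewrite inE.
Qed.

Definition Rewind : stm 9 := Sq (Act ord_max (move_act MLeft))
  (Sq (Wh ord_max nonblank (Act ord_max (move_act MLeft)))
      (Act ord_max (move_act MRight))).

Lemma leading_bits_cat out (r : seq (symbol void)) :
  leading_bits ([seq Some (inl b) | b <- out] ++ None :: r) = out.
Proof. by elim: out => //= b out ->. Qed.

Lemma tri_rewind (T : tapes 9) out : T ord_max = otape out ->
  exists2 T', tri Rewind T T' (1 + ((2 * size out + 1) + 1))
    & tape_output (T' ord_max) = out.
Proof.
move=> To; pose l : seq (symbol void) := [seq Some (inl b) | b <- out].
pose n := size out; have sl : size l = n by rewrite size_map.
pose t m : tape void := (behead (rev (take (n - m) l)),
  head None (rev (take (n - m) l)), drop (n - m) l ++ [:: None]).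
eexists.
  apply: tri_seq (tri_act _ _ _) _; apply: tri_seq (tri_act _ _ _).
  apply: (tri_wh_act (t := t)).
  - rewrite upd_same To /t subn0 take_oversize ?sl // drop_oversize ?sl //.
  - move=> m lt; rewrite /t; have -> : n - m = (n - m.+1).+1 by lia.
    rewrite (take_nth None) ?sl; last by lia.
    by rewrite rev_rcons /= (nth_map true) //; rewrite -/n; lia.
  - by rewrite /t subnn take0.
  - move=> m lt; rewrite /t; have -> : n - m = (n - m.+1).+1 by lia.
    rewrite (take_nth None) ?sl; last by lia.
    by rewrite rev_rcons (drop_nth None (n := n - m.+1)) ?sl //; lia.
rewrite !upd_same /t subnn take0 drop0 /=.
rewrite /tape_output /act_tape /=.
have := leading_bits_cat out [::]; rewrite -/l.
by case: (l).
Qed.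

End Writer.

Definition Z0 : {set 'I_10} := [set c_0; c_i; c_j].

Theorem emit_polytime (p : {poly nat}) (E : emit 9) : wf ctrs Z0 E ->
  polytime_computable (fun w => den w E
    (mkenv (size w) p.[size w]%R 0 p.[size w]%R (p.[size w]%R + 3) (p.[size w]%R + 3))).
Proof.
move=> wE; pose s := polyseq p.
pose B n := n + hval s n + 3.
pose tot n := ((3 * n + 1) + (n * 5 + 4)) + (horner_cost s n +
  (((hval s n * (3 + 4) + 4) + ((3 + 1) + (3 + 1))) + (cost (B n) E +
   (1 + ((2 * cost (B n) E + 1) + 1))))).
have pb_h : polyb (horner_cost s).
  by elim: {B tot} s => [|a s IH] /=; polyb.
have pB : polyb B by polyb.
have pc : polyb (fun n => cost (B n) E) by apply: polyb_cost.
have [q hq] : exists q : {poly nat}, forall n, tot n <= q.[n]%R.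
  by apply: polyb_poly; rewrite /tot; polyb.
pose P := Sq Count (Sq (Horner s) (Sq Fan (Sq (compile E) Rewind))).
exists 9, (stm_tm P), q => w.
set n := size w; rewrite (hval_horner p n) -/s; set e := mkenv _ _ _ _ _ _.
have ne : ord0 != ord_max :> 'I_10 by [].
have r0 : rep w ctrs (mkenv 0 0 0 0 0 0, 0, [::]) (tm_init (stm_tm P) w).2.
  split; rewrite ?inE //.
  (* On the empty input the head already scans one blank, which [inp] counts as explored. *)
  - rewrite ffunE eqxx; exists ([seq Some (inl b) | b <- w] ++ nseq (w == [::]) None).
      split; first by rewrite size_cat size_map size_nseq; case: (w).
      move=> j; rewrite nth_cat size_map /input_at.
      case: ltnP => h; first by rewrite !(nth_map true).
      rewrite [RHS](congr1 (omap _) (nth_default _ _)) ?size_map //.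
      by rewrite nth_nseq if_same.
    by case: (w) => [|b u] //=; rewrite cats0 drop0.
  - by rewrite ffunE.
  - by move=> c cC; rewrite !ffunE; exists 0, 0; move: cC; rewrite inE; case: c => [[|[|[|[|[|[|[|m]]]]]]]] // lt; case: eqP => //; rewrite /= nth_default.
have [T1 [t1 r1 _]] := hoare_count ne r0.
have [T2 [t2 r2 _]] := @hoare_horner w s n ne _ r1.
have [T3 [t3 r3 _]] := @hoare_fan w n (hval s n) ne _ r2.
have eB c : e c <= B n.
  by rewrite /e /B ffunE; case: c => [[|[|[|[|[|[|[|m]]]]]]]] lt //=; rewrite ?nth_nil; lia.
have eZ z : z \in Z0 -> e z = 0.
  by rewrite !inE => /orP[/orP[]|] /eqP->; rewrite ffunE.
have [T4 [t4 r4 _]] := @hoare_emit _ w _ _ _ _ _ [::] wE (fun c _ => eB c) eZ ne _ r3.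
case: r4 => _ _ _ /= To _.
have [T5 t5 o5] := tri_rewind To.
have so : size (den w E e) <= cost (B n) E by apply: size_den wE _ => c _; apply: eB.
have [|t le run] := @tri_tm_run _ P w T5 (tot n).
  apply: tri_le (tri_seq t1 (tri_seq t2 (tri_seq t3 (tri_seq t4 t5)))) _.
  by rewrite /tot; do 4 rewrite leq_add2l; rewrite leq_add2l !leq_add2r leq_mul2l so.
exists t; rewrite run; split=> //; exact: leq_trans le (hq n).
Qed.

(** * Writing the system *)

(** In unary, addition is concatenation; a variable index becomes blocks of marks printed by loops,
    followed by a constant. *)
Lemma enc_natD m n : enc_nat (m + n) = nseq m true ++ enc_nat n.
Proof. by rewrite /enc_nat nseqD rcons_cat. Qed.

Opaque enc_nat.

Lemma flatten_nseq_nseq (T : Type) (x : T) m n :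
  flatten (nseq m (nseq n x)) = nseq (m * n) x.
Proof. by elim: m => //= m ->; rewrite mulSn nseqD. Qed.

Section EncodeLists.
Variable v : nat.

Lemma enc_cseq (l : seq (com 'I_2 'I_v.+1 'I_2)) :
  enc_com (cseq l) = flatten [seq enc_nat 4 ++ enc_com c | c <- l] ++ enc_nat 0.
Proof. by elim: l => //= c l ->; rewrite -!catA. Qed.

Lemma enc_calt (l : seq (com 'I_2 'I_v.+1 'I_2)) :
  enc_com (calt l) = flatten [seq enc_nat 5 ++ enc_com c | c <- l] ++
    (enc_nat 1 ++ enc_nat 0 ++ enc_nat 0).
Proof. by elim: l => //= c l ->; rewrite -!catA. Qed.

Lemma enc_flatten_blocks (F : nat -> seq bool) (f : nat -> seq (block 'I_v.+1))
    (l : seq nat) :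
  (forall j, j \in l -> F j = flatten [seq enc_nat 4 ++ enc_com (com_block b) | b <- f j]) ->
  flatten (map F l) =
  flatten [seq enc_nat 4 ++ enc_com c | c <- map (@com_block _) (flatten (map f l))].
Proof.
elim: l => //= j l IH h; rewrite !map_cat flatten_cat -IH; last first.
  by move=> i il; apply: h; rewrite in_cons il orbT.
by rewrite h ?mem_head // -map_comp.
Qed.

End EncodeLists.

Section Write.
Variables (G : finType) (head_rule : G -> G -> G) (cell_rule : G -> G -> G -> G -> G)
  (left_of : G -> G) (icell : option bool -> G) (acc : pred G).

Local Notation svar := (svar G).
Local Notation nsel := (nsel G).
Local Notation sblock := (seq (seq (bool * svar))).

(* [locked] keeps [simpl] from unfolding the emitters. *)
Definition em_cat (l : seq (emit 9)) : emit 9 :=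
  locked (foldr (@ECat 9) (EStr 9 [::]) l).

Lemma den_em_cat w l e : den w (em_cat l) e = flatten [seq den w P e | P <- l].
Proof. by rewrite /em_cat -lock; elim: l => //= P l ->. Qed.

Lemma wf_em_cat D Z l : wf D Z (em_cat l) = all (wf D Z) l.
Proof. by rewrite /em_cat -lock; elim: l => //= P l ->. Qed.

(** Within this range [inord] returns the intended index, so the printed number is that of the
    variable. *)
Definition fits (X i j : nat) (x : svar) : bool :=
  (i + x.1.1 <= X) && (j + x.1.2 < X.+3).

(** [ci != c_N'] because the loop over [c_N'] is nested in the one over [ci]. *)
Definition addressable (D : {set 'I_10}) (ci cj : 'I_10) : bool :=
  [&& ci \in D, cj \in D, c_N' \in D & ci != c_N'].

Definition address (e : env 9) (ci cj : 'I_10) (X i j : nat) : bool :=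
  [&& e ci == i, e cj == j & e c_N' == X.+3].

Definition em_tag (n : nat) (P : emit 9) : emit 9 := ECat (EStr 9 (enc_nat n)) P.

Definition em_var (ci cj : 'I_10) (x : svar) : emit 9 :=
  em_cat [:: ERep ci (ERep c_N' (EStr 9 (nseq nsel true)));
             em_cat (nseq x.1.1 (ERep c_N' (EStr 9 (nseq nsel true))));
             ERep cj (EStr 9 (nseq nsel true));
             EStr 9 (enc_nat (x.1.2 * nsel + enum_rank x.2))].

Lemma wf_em_var D Z ci cj x : addressable D ci cj -> wf D Z (em_var ci cj x).
Proof.
move=> /and4P[iD jD ND iN].
rewrite wf_em_cat /= !inE iD jD ND eq_sym iN wf_em_cat /= !andbT.
by rewrite all_nseq /= ND orbT.
Qed.

Lemma den_em_var w e ci cj X i j x : address e ci cj X i j -> fits X i j x ->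
  den w (em_var ci cj x) e = enc_nat (inst_var X i j x).
Proof.
move=> /and3P[/eqP ei /eqP ej /eqP eN].
case: x => [[a d] s] /andP[/= ha hd]; rewrite val_var //= /var_index /em_var.
rewrite den_em_cat /= den_em_cat map_nseq /= eN ei ej !flatten_nseq_nseq cats0.
by rewrite -!enc_natD; congr enc_nat; lia.
Qed.

Definition em_act (ci cj : 'I_10) (a : bool * svar) : emit 9 :=
  if a.1 then em_cat [:: EStr 9 (enc_nat 4 ++ enc_nat 7 ++ enc_nat 0); em_var ci cj a.2;
                         EStr 9 (enc_nat 1 ++ enc_nat 1 ++ enc_nat 0)]
  else em_cat [:: EStr 9 (enc_nat 8); em_var ci cj a.2; EStr 9 (enc_nat 1)].

Lemma wf_em_act D Z ci cj a : addressable D ci cj -> wf D Z (em_act ci cj a).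
Proof. by move=> h; rewrite /em_act; case: ifP => _; rewrite wf_em_cat /= wf_em_var. Qed.

Lemma den_em_act w e ci cj X i j a : address e ci cj X i j -> fits X i j a.2 ->
  den w (em_act ci cj a) e = enc_com (com_act (a.1, inst_var X i j a.2)).
Proof.
move=> h fa; rewrite /em_act /com_act; case: a fa => -[] x fa /=;
by rewrite den_em_cat /= (den_em_var _ h) //= ?cats0 -?catA.
Qed.

Definition em_rd (ci cj : 'I_10) (x : svar) : emit 9 :=
  em_cat [:: EStr 9 (enc_nat 4 ++ enc_nat 7 ++ enc_nat 0); em_var ci cj x;
             EStr 9 (enc_nat 1 ++ enc_nat 2 ++ (enc_nat 1 ++ enc_nat 0) ++
                     (enc_nat 0 ++ enc_nat 0) ++ (enc_nat 0 ++ enc_nat 1) ++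
                     (enc_nat 0 ++ enc_nat 0))].

Lemma wf_em_rd D Z ci cj x : addressable D ci cj -> wf D Z (em_rd ci cj x).
Proof. by move=> h; rewrite wf_em_cat /= wf_em_var. Qed.

Lemma den_em_rd w e ci cj X i j x : address e ci cj X i j -> fits X i j x ->
  den w (em_rd ci cj x) e = enc_com (rd (inst_var X i j x)).
Proof. by move=> h fx; rewrite den_em_cat /= (den_em_var _ h) //= -?catA. Qed.

Definition em_line ci cj (ln : seq (bool * svar)) : emit 9 :=
  em_cat (rcons [seq em_tag 4 (em_act ci cj a) | a <- ln] (EStr 9 (enc_nat 0))).

Definition em_block ci cj (b : sblock) : emit 9 :=
  em_cat (rcons [seq em_tag 5 (em_line ci cj ln) | ln <- b]
                (EStr 9 (enc_nat 1 ++ enc_nat 0 ++ enc_nat 0))).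

Lemma wf_em_block D Z ci cj b : addressable D ci cj -> wf D Z (em_block ci cj b).
Proof.
move=> h; rewrite wf_em_cat all_rcons /= all_map; apply/allP => ln _ /=.
by rewrite wf_em_cat all_rcons /= all_map; apply/allP => a _; apply: wf_em_act.
Qed.

Lemma den_em_block w e ci cj X i j (b : sblock) : address e ci cj X i j ->
  (forall ln a, ln \in b -> a \in ln -> fits X i j a.2) ->
  den w (em_block ci cj b) e = enc_com (com_block (inst X i j b)).
Proof.
move=> h fb; rewrite /com_block enc_calt den_em_cat map_rcons flatten_rcons /=.
congr (_ ++ _); rewrite /inst -!map_comp; congr flatten; apply/eq_in_map => ln lb /=.
congr (_ ++ _); rewrite den_em_cat map_rcons flatten_rcons /com_line enc_cseq /=.
congr (_ ++ _); rewrite /inst_line -!map_comp; congr flatten; apply/eq_in_map => a al /=.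
by rewrite (den_em_act _ h) //; apply: fb lb al.
Qed.

Lemma fits_tile X v cs j : all (fun c : bool * nat * G => j + c.1.2 < X.+3) cs ->
  forall a, a \in tile_line v cs -> fits X 0 j a.2.
Proof.
by move=> /allP h a /tile_line_in[c [g [/h cc _ ->]]]; rewrite /fits /=.
Qed.

Lemma fits_others X i j f g (a : bool * svar) : (forall g', fits X i j (f g')) ->
  a \in others f g -> fits X i j a.2.
Proof. by move=> h /others_in[g' _ ->]; apply: h. Qed.

Local Notation e0 w X := (mkenv (size w) X 0 X (X + 3) (X + 3)).

Definition em_leaf (p : bool * G) : emit 9 := em_cat
  [:: em_tag 4 (em_block c_0 c_0 (leaf_first head_rule cell_rule left_of p.1 p.2));
      EFor c_j c_X (em_tag 4 (em_block c_0 c_j (leaf_mid cell_rule p.1 p.2)));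
      em_tag 4 (em_block c_0 c_X (leaf_last G p.1));
      em_tag 4 (em_act c_0 c_0 (false, (0, 0, (p.1, None)))); EStr 9 (enc_nat 0)].

Lemma wf_em_leaf p : wf ctrs Z0 (em_leaf p).
Proof.
by rewrite wf_em_cat /= !wf_em_block ?wf_em_act /addressable ?inE.
Qed.

Lemma den_em_leaf w X p : den w (em_leaf p) (e0 w X) =
  enc_com (com_thread (leaf head_rule cell_rule left_of X p.1 p.2)).
Proof.
have a0 : address (e0 w X) c_0 c_0 X 0 0 by rewrite /address !ffunE /= addn3.
have aX : address (e0 w X) c_0 c_X X 0 X by rewrite /address !ffunE /= addn3 !eqxx.
have aj j : address (upd (e0 w X) c_j j) c_0 c_j X 0 j.
  by rewrite /address !ffunE /= addn3 !eqxx.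
rewrite /com_thread enc_cseq den_em_cat /= !cats0 !map_cat.
rewrite !flatten_cat /= !cats0 -!catA; congr (_ ++ _).
rewrite (den_em_block _ a0); last first.
  by move=> ln a /mapP[q _ ->]; apply: fits_tile => /=; lia.
congr (_ ++ _); rewrite -!map_comp ffunE /=; congr (flatten _ ++ _).
  apply/eq_in_map => j; rewrite mem_iota add0n => /andP[_ jX] /=.
  rewrite (den_em_block _ (aj j)) //.
  by move=> ln a /mapP[q _ ->]; apply: fits_tile => /=; lia.
rewrite (den_em_block _ aX); last first.
  by move=> ln a /mapP[q _ ->]; apply: fits_tile => /=; lia.
by rewrite (den_em_act _ a0) //= -!catA.
Qed.

Definition em_up (v : bool) : emit 9 := em_cat
  [:: em_tag 4 (em_rd c_i c_0 (0, 0, (false, None)));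
      em_tag 4 (em_rd c_i c_0 (0, 0, (true, None)));
      EFor c_j c_N (em_cat [:: em_tag 4 (em_block c_i c_j (up_source G v));
                               em_tag 4 (em_block c_i c_j (up_middle G));
                               em_tag 4 (em_block c_i c_j (up_target G v))]);
      em_tag 4 (em_act c_i c_0 (false, (1, 0, (v, None)))); EStr 9 (enc_nat 0)].

(** The context is the body of the loop over levels: [c_K] is driving it and [c_i] holds the
    level. *)
Lemma wf_em_up v : wf (ctrs :\ c_K) (Z0 :\ c_i) (em_up v).
Proof.
rewrite wf_em_cat /= wf_em_cat /= !wf_em_rd ?wf_em_act ?wf_em_block /addressable;
by rewrite !inE.
Qed.

Lemma den_em_up w X v i : i < X ->
  den w (em_up v) (upd (e0 w X) c_i i) = enc_com (com_thread (up G X i v)).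
Proof.
move=> iX; have iX' := ltnW iX.
have ad : address (upd (e0 w X) c_i i) c_i c_0 X i 0.
  by rewrite /address !ffunE addn3 /= !eqxx.
have aj j : address (upd (upd (e0 w X) c_i i) c_j j) c_i c_j X i j.
  by rewrite /address !ffunE addn3 /= !eqxx.
have E : flatten [seq den w (em_cat
      [:: em_tag 4 (em_block c_i c_j (up_source G v));
          em_tag 4 (em_block c_i c_j (up_middle G));
          em_tag 4 (em_block c_i c_j (up_target G v))]) (upd (upd (e0 w X) c_i i) c_j j)
      | j <- cells X] = _ := enc_flatten_blocks (f := fun j =>
        [:: inst X i j (up_source G v); inst X i j (up_middle G);
            inst X i j (up_target G v)]) _.
rewrite /com_thread enc_cseq den_em_cat /= !cats0 !map_cat.
rewrite !(den_em_rd _ ad) /fits /= ?addn0 ?iX' //.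
rewrite (den_em_act _ ad) /fits /= ?addn1 ?iX //.
rewrite !flatten_cat /= cats0 !ffunE /= -/(cells X) E ?catA //.
move=> j; rewrite mem_cells => jN.
rewrite den_em_cat /= !(den_em_block _ (aj j)) //.
- move=> ln a /mapP[g _ ->]; rewrite in_cons => /orP[/eqP->|].
    by rewrite /fits /= !addn0 iX'.
  by apply: fits_others => g'; rewrite /fits /= addn0 addn1 iX.
- move=> ln a /mapP[g _ ->]; rewrite !inE => /orP[] /eqP->;
    by rewrite /fits /= !addn0 iX'.
- move=> ln a /mapP[g _ ->]; rewrite in_cons => /orP[/eqP->|].
    by rewrite /fits /= !addn0 iX'.
  by apply: fits_others => g'; rewrite /fits /= addn0 addn1 iX.
Qed.

(** The only part of the instance that depends on the letters of the input and not just on its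
    length. *)
Definition em_goal : emit 9 := em_cat
  [:: em_tag 4 (em_rd c_K c_0 (0, 0, (false, None)));
      EFor c_j c_N (em_cat
        [:: ECase c_j (fun o => em_tag 4 (em_block c_K c_j (goal_source icell o)));
            em_tag 4 (em_block c_K c_j (goal_any G))]);
      em_tag 4 (em_block c_K c_0 (goal_target acc));
      em_tag 4 (EStr 9 (enc_nat 2)); EStr 9 (enc_nat 0)].

Lemma wf_em_goal : wf ctrs Z0 em_goal.
Proof.
rewrite wf_em_cat /= wf_em_cat /= !wf_em_rd ?wf_em_block /addressable;
by rewrite !inE.
Qed.

Lemma den_em_goal w X :
  den w em_goal (e0 w X) = enc_com (com_thread (goal icell acc X w)).
Proof.
have ad : address (e0 w X) c_K c_0 X X 0.
  by rewrite /address !ffunE addn3 /= !eqxx.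
have aj j : address (upd (e0 w X) c_j j) c_K c_j X X j.
  by rewrite /address !ffunE addn3 /= !eqxx.
have E : flatten [seq den w (em_cat
      [:: ECase c_j (fun o => em_tag 4 (em_block c_K c_j (goal_source icell o)));
          em_tag 4 (em_block c_K c_j (goal_any G))]) (upd (e0 w X) c_j j)
      | j <- cells X] = _ := enc_flatten_blocks (f := fun j =>
        [:: inst X X j (goal_source icell (input_at w j)); inst X X j (goal_any G)]) _.
rewrite /com_thread enc_cseq den_em_cat /= !cats0 !map_cat.
rewrite !(den_em_rd _ ad) /fits /= ?addn0 ?leqnn //.
rewrite (den_em_block _ ad); last first.
  by move=> ln a /mapP[g _ ->]; rewrite inE => /eqP->; rewrite /fits /= !addn0 leqnn.
rewrite !flatten_cat /= !cats0 !ffunE /= -/(cells X) E ?catA //.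
move=> j; rewrite mem_cells => jN.
rewrite den_em_cat /= upd_same !(den_em_block _ (aj j)) //.
- by move=> ln a /mapP[g _ ->]; rewrite inE => /eqP->; rewrite /fits /= !addn0 leqnn.
- by move=> ln a; rewrite inE => /eqP->; rewrite inE => /eqP->; rewrite /fits /= !addn0 leqnn.
Qed.

(** The marks for [X] levels and for one more, closed by [enc_nat 1], make up the number of
    variables; the next two [enc_nat 1] are the domain parameter and the initial value. *)
Definition em_system : emit 9 := em_cat
  [:: EStr 9 (enc_nat 2); ERep c_K (ERep c_N' (EStr 9 (nseq nsel true)));
      ERep c_N' (EStr 9 (nseq nsel true)); EStr 9 (enc_nat 1 ++ enc_nat 1 ++ enc_nat 1);
      em_cat [seq em_tag 5 (em_leaf p) | p <- enum {: bool * G}];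
      EFor c_i c_K (em_cat [:: em_tag 5 (em_up false); em_tag 5 (em_up true)]);
      em_tag 5 em_goal; EStr 9 (enc_nat 1 ++ enc_nat 0 ++ enc_nat 0)].

Lemma wf_em_system : wf ctrs Z0 em_system.
Proof.
rewrite wf_em_cat /= wf_em_goal !wf_em_cat /= all_map !wf_em_up.
rewrite !inE /= ?andbT.
by apply/allP => p _; apply: wf_em_leaf.
Qed.

Definition reduction_system (w : seq bool) (X : nat) : system :=
  @MkSystem 2 (nvars G X).+1 1 ord_max
    (com_prog (prog head_rule cell_rule left_of icell acc X w)).

Lemma den_em_system w X : den w em_system (e0 w X) = enc_system (reduction_system w X).
Proof.
rewrite /enc_system /= /com_prog enc_calt den_em_cat /= cats0.
congr (_ ++ _); rewrite !ffunE /= !flatten_nseq_nseq !catA -nseqD -enc_natD -!catA.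
congr (enc_nat _ ++ _); first by rewrite /nvars; lia.
do 2 congr (_ ++ _); rewrite !map_cat !flatten_cat -!catA; congr (_ ++ _).
  rewrite den_em_cat -!map_comp; congr flatten; apply: eq_map => p /=.
  by rewrite den_em_leaf.
rewrite /= den_em_goal -!catA; congr (_ ++ _).
have : forall i, i \in iota 0 X -> i < X by move=> i; rewrite mem_iota.
elim: (iota 0 X) => //= i l IH h; rewrite IH => [|j jl]; last first.
  by apply: h; rewrite in_cons jl orbT.
by rewrite den_em_cat /= !den_em_up ?h ?mem_head // cats0 -!catA.
Qed.

End Write.

Theorem mainTheorem5 : PSPACE_hard env_nocas_acyc_safety.
Proof.
move=> L [k [M [p hM]]].
(* Large enough to bound the space and to make [2 ^ X] exceed the number of configurations; the
   alphabet is a constant of [M]. *)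
pose q : {poly nat} := (#|{: cell M}|%:P * (p + 1%:P))%R.
have qE n : q.[n]%R = #|{: cell M}| * p.[n]%R.+1.
  by rewrite /q hornerM hornerD !hornerC -[p.[n]%R.+1]addn1.
have cell_gt0 : 0 < #|{: cell M}|.
  by apply/card_gt0P; exists (tm_start M, [ffun=> (None, None)]).
pose acc (g : cell M) := tm_accepting g.1.
pose S (w : seq bool) := reduction_system (@head_rule k M) (@cell_rule k M)
  (@left_of k M) (@icell k M) acc w q.[size w]%R.
pose E := em_system (@head_rule k M) (@cell_rule k M) (@left_of k M) (@icell k M) acc.
exists (fun w => enc_system (S w)); split.
  have [k' [M' [r hr]]] := emit_polytime q (wf_em_system _ _ _ _ _ : wf ctrs Z0 E).
  exists k', M', r => w; have [t [h1 h2 h3]] := hr w.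
  by exists t; split=> //; rewrite h3 den_em_system.
move=> w; have [hs [t [ht hL]]] := hM w.
have hacc : system_unsafe (S w) <-> tm_accepting (tm_run M w t).1.
  rewrite (@tm_accepting_ca _ _ _ p.[size w]%R hs q.[size w]%R) //.
  - exact: prog_correct.
  - by rewrite qE -[X in X <= _]mul1n; apply: leq_mul.
  - by rewrite qE.
(* A yes-instance is given by some system with this code; injectivity of the encoding identifies it
   with [S w]. *)
split=> [/hL/hacc uS|[S' [/enc_system_inj <- _ _ /hacc/hL//]]].
exists (S w); split=> //; [exact: nocas_com_prog|exact: acyc_com_prog].
Qed.
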